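(* Let $m\ge 1$ be an integer and let $p\in\mathbb Z$. The vectors $$a_{i_1}a_{i_2}\cdots a_{i_k}v_p,\qquad k=0,1,2,\ldots,\quad i_1\le p-1,\quad i_\alpha-i_{\alpha+1}\ge 2m\ \ (1\le\alpha<k),$$ form a basis of $V_{(m),p}$. Moreover, for every $N\in\mathbb Z$, the images of the vectors $a_{i_1}\cdots a_{i_k}v_p$ with $k\ge 0$, $i_1\le p-1$, $i_\alpha-i_{\alpha+1}\ge 2m$ $(1\le\alpha<k)$ and $i_k>N$ form a basis of the quotient space $V_{(m),p}/\mathrm{span}\{a_iV_{(m),p}:\ i\le N\}$. (For $k=0$ the vector is $v_p$ and the conditions are empty.)
   Context: Fix an integer $m\ge 1$. Let $H$ be the Heisenberg Lie algebra with basis $h_i$, $i\in\mathbb Z$, $[h_i,h_j]=i\,\delta_{i+j,0}$ (the central element acts as $1$). For a scalar $\lambda$ let $H_\lambda$ be the highest weight (Fock) representation with highest weight vector $|\lambda\rangle$: $h_i|\lambda\rangle=0$ for $i>0$, $h_0|\lambda\rangle=\lambda|\lambda\rangle$, and $H_\lambda=\mathbb C[h_{-1},h_{-2},\ldots]|\lambda\rangle$ is free over $\mathbb C[h_{-1},h_{-2},\ldots]$. For $0\le i\le 2m-1$ put $L_{(m),i}=\bigoplus_{n\in\mathbb Z}H_{(2nm+i)/\sqrt{2m}}$ (the irreducible representations of the lattice vertex algebra of the lattice $\mathbb Zl$, $\langle l,l\rangle=2m$). On $\bigoplus_i L_{(m),i}$ the bosonic vertex operator is $$\phi_{\sqrt{2m}}(z)=\exp\Big(\sqrt{2m}\sum_{n>0}\tfrac{h_{-n}}{n}z^n\Big)\exp\Big(-\sqrt{2m}\sum_{n>0}\tfrac{h_{n}}{n}z^{-n}\Big)\,T\,z^{\sqrt{2m}\,h_0}=\sum_{n\in\mathbb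 Z}a_nz^{-n-1},$$ where $T$ commutes with all $h_i$, $i\ne0$, and $T|\lambda\rangle=|\lambda+\sqrt{2m}\rangle$. The operators $a_n$ pairwise commute. Put $v_p=\left|\frac{-p}{\sqrt{2m}}\right\rangle$ for $p\in\mathbb Z$; then $a_iv_p=0$ for $i\ge p$. The principal subspace is $V_{(m),p}=\mathbb C[a_{p-1},a_{p-2},\ldots]\cdot v_p$. *)

(* Defs.v *)
From HB Require Import structures.
From mathcomp Require Import all_boot all_order all_algebra.
From mathcomp Require Import finmap.
From mathcomp.multinomials Require Import monalg.
From mathcomp Require Import zify.

Set Implicit Arguments.
Unset Strict Implicit.
Unset Printing Implicit Defensive.

Import Order.TTheory GRing.Theory Num.Theory.

Local Open Scope ring_scope.

Section LinearAlgebra.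
Variables (C : fieldType) (V : lmodType C).

Definition lin_span (S : V -> Prop) (x : V) : Prop :=
  exists s : seq (C * V),
    (forall t, t \in s -> S t.2) /\ x = \sum_(t <- s) t.1 *: t.2.

(* The classes modulo W of the vectors b i, for i satisfying P, form a basis
   of the quotient U / W of the subspace U by its subspace W.  The family is
   indexed: if b i = b j with i != j, it is not linearly independent. *)
Definition quotient_basis (I : eqType) (P : I -> Prop) (b : I -> V)
    (U W : V -> Prop) : Prop :=
  [/\ forall x, W x -> U x,
      forall i, P i -> U (b i),
      forall (s : seq I) (c : I -> C),
        uniq s -> (forall i, i \in s -> P i) ->
        W (\sum_(i <- s) c i *: b i) -> forall i, i \in s -> c i = 0
    & forall x, U x -> exists (s : seq I) (c : I -> C),
        (forall i, i \in s -> P i) /\ W (x - \sum_(i <- s) c i *: b i)].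

Definition subspace_basis (I : eqType) (P : I -> Prop) (b : I -> V)
    (U : V -> Prop) : Prop :=
  quotient_basis P b U (fun x => x = 0).

(* Coefficient of z^k in (\sum_(n >= 1) A n z^n)^j; A 0 plays no role. *)
Fixpoint pow_coef (A : nat -> V -> V) (j k : nat) (x : V) : V :=
  if j is j'.+1 then \sum_(1 <= n < k.+1) A n (pow_coef A j' (k - n) x)
  else if k == 0%N then x else 0.

(* Coefficient of z^k in exp (\sum_(n >= 1) A n z^n); the j-th power of the
   series starts in degree j, so only j <= k contributes. *)
Definition exp_coef (A : nat -> V -> V) (k : nat) (x : V) : V :=
  \sum_(j < k.+1) (j`!%:R)^-1 *: pow_coef A j k x.

Lemma pow_coef_eq0 (A : nat -> V -> V) (j k : nat) (x : V) :
  (forall n, A n 0 = 0) -> (k < j)%N -> pow_coef A j k x = 0.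
Proof.
move=> A0; elim: j k => [//|j IHj] k lt_kj /=.
rewrite big_nat big1 // => n /andP[n_gt0 le_nk].
by rewrite IHj // ltn_subLR // (leq_trans lt_kj) // -add1n leq_add2r.
Qed.

End LinearAlgebra.

Section VertexOperator.
Variable C : numClosedFieldType.

(* The direct sum of the Fock spaces H_(q / sqrt (2 m)) over q : int, given by
   its basis: the pair (q, mu) stands for
   (\prod_j h_(-(j + 1)) ^ (mu j)) |q / sqrt (2 m)>. *)
Definition fock_index := (int * {cmonom nat})%type.
Definition fock : lmodType C := {malg C[fock_index]}.

Definition lin_ext (f : fock_index -> fock) (x : fock) : fock :=
  \sum_(k <- msupp x) x@_k *: f k.

Lemma lin_ext_is_linear f : linear (lin_ext f).
Proof.
have lin_extEw (d : {fset fock_index}) g : (msupp g `<=` d)%fset ->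
    lin_ext f g = \sum_(k <- d) g@_k *: f k.
  move=> le_gd; rewrite /lin_ext (big_fset_incl _ le_gd) // => k _.
  by rewrite -mcoeff_eq0 => /eqP ->; rewrite scale0r.
move=> c x y.
set d := (msupp (c *: x + y) `|` (msupp x `|` msupp y))%fset.
rewrite !(lin_extEw d) ?fsubsetUl //; first last.
- by rewrite fsubsetU // fsubsetUl orbT.
- by rewrite fsubsetU // fsubsetUr orbT.
rewrite scaler_sumr -big_split /=; apply: eq_bigr => k _.
by rewrite mcoeffD mcoeffZ scalerDl scalerA.
Qed.

HB.instance Definition _ f :=
  GRing.isLinear.Build C fock fock _ (lin_ext f) (lin_ext_is_linear f).

Lemma lin_extU f k : lin_ext f << k >> = f k.
Proof. by rewrite /lin_ext msuppU oner_eq0 big_seq_fset1 mcoeffUU scale1r. Qed.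

Definition vac (q : int) : fock := << (q, onecm nat) : fock_index >>.

Variable m : nat.

Definition alpha : C := sqrtC (2 * m)%:R.

(* Negz j is -(j + 1).  In the variables x_j = h_(-(j + 1)), the operator
   h_(j + 1) is (j + 1) d/dx_j.  See heis_comm for the Heisenberg relations. *)
Definition heis (i : int) : fock -> fock :=
  lin_ext (fun k : fock_index => match i with
    | Posz 0 => (k.1%:~R / alpha) *: << k >>
    | Posz j.+1 =>
        (j.+1 * k.2 j)%:R *: << (k.1, divcm k.2 (ucm j)) : fock_index >>
    | Negz j => << (k.1, mulcm k.2 (ucm j)) : fock_index >>
    end).

HB.instance Definition _ (i : int) :=
  GRing.Linear.copy (heis i) (lin_ext _).

(* |lambda> goes to |lambda + sqrt (2 m)>, i.e. q to q + 2 m. *)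
Definition shift : fock -> fock :=
  lin_ext (fun k : fock_index => << (k.1 + (2 * m)%:Z, k.2) : fock_index >>).

HB.instance Definition _ :=
  GRing.Linear.copy shift (lin_ext _).

Definition creation_coef : nat -> fock -> fock :=
  exp_coef (fun n x => (alpha / n%:R) *: heis (- n%:Z) x).

(* annihilation_coef l is the coefficient of z^(- l): the series is in z^-1. *)
Definition annihilation_coef : nat -> fock -> fock :=
  exp_coef (fun n x => - (alpha / n%:R) *: heis n%:Z x).

Definition weight (mu : {cmonom nat}) : nat :=
  (\sum_(j <- finsupp mu) j.+1 * mu j)%N.

Lemma weightM (mu nu : {cmonom nat}) :
  weight (mulcm mu nu) = (weight mu + weight nu)%N.
Proof.
have weightEw (d : {fset nat}) (rho : {cmonom nat}) :
    (finsupp rho `<=` d)%fset -> weight rho = (\sum_(j <- d) j.+1 * rho j)%N.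
  move=> le_d; rewrite /weight (big_fset_incl _ le_d) // => j _.
  by rewrite memNfinsupp => /eqP ->; rewrite muln0.
set d := (finsupp (mulcm mu nu) `|` (finsupp mu `|` finsupp nu))%fset.
rewrite !(weightEw d) ?fsubsetUl //; first last.
- by rewrite fsubsetU // fsubsetUl orbT.
- by rewrite fsubsetU // fsubsetUr orbT.
by rewrite -big_split; apply: eq_bigr => j _; rewrite mulcmE mulnDr.
Qed.

Lemma weightU (j : nat) : weight (ucm j) = j.+1.
Proof. by rewrite /weight mdomU big_seq_fset1 ucmE eqxx muln1. Qed.

Lemma annihilation_coef_eq0 (l : nat) (k : fock_index) :
  (weight k.2 < l)%N -> annihilation_coef l << k >> = 0.
Proof.
pose lowered (w : nat) (x : fock) :=
  forall k', (weight k'.2 + w)%N != weight k.2 -> x@_k' = 0.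
have lowered_sum w (I : Type) (r : seq I) (P : pred I) (F : I -> fock) :
    (forall i, P i -> lowered w (F i)) -> lowered w (\sum_(i <- r | P i) F i).
  move=> lowF k' wk'; rewrite raddf_sum big1 // => i Pi; exact: lowF.
have lowered_scale w (c : C) x : lowered w x -> lowered w (c *: x).
  by move=> lowx k' wk'; rewrite mcoeffZ lowx // mulr0.
have lowered_heis w n x :
    lowered w x -> lowered (w + n.+1)%N (heis n.+1 x).
  move=> lowx; apply: (lowered_sum _ _ _ predT) => k1 _.
  have [wk1|/lowx ->] := eqVneq (weight k1.2 + w)%N (weight k.2); last first.
    by rewrite scale0r => k' _; rewrite mcoeff0.
  apply: lowered_scale => k' wk'; rewrite mcoeffZ mcoeffU.
  have [mu0|mu_gt0] := posnP (k1.2 n); first by rewrite mu0 muln0 mul0r.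
  case: eqVneq => [k'E|_]; last by rewrite mulr0.
  case/negP: wk'; rewrite -k'E /= -wk1; apply/eqP.
  have {2}-> : k1.2 = mulcm (divcm k1.2 (ucm n)) (ucm n).
    apply/esym/eqP/cmP => v; rewrite mulcmE divcmE ucmE.
    by case: eqVneq => [<-|_]; rewrite ?subnK // subn0 addn0.
  by rewrite weightM weightU addnAC addnA.
move=> lt_kl; pose A n (x : fock) := - (alpha / n%:R) *: heis n%:Z x.
have lowered_pow j l' : lowered l' (pow_coef A j l' << k >>).
  elim: j l' => [|j IHj] l' /=.
    case: eqVneq => [-> k'|_ k' _]; last by rewrite mcoeff0.
    by rewrite addn0 mcoeffU; case: (eqVneq k k') => [<-|//]; rewrite eqxx.
  rewrite big_nat; apply: lowered_sum => -[|n] //= lt_nl.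
  apply: lowered_scale; rewrite -[X in lowered X](@subnK n.+1 l') //.
  exact: lowered_heis.
apply/malgP => k'; rewrite mcoeff0.
have: lowered l (annihilation_coef l << k >>).
  by apply: lowered_sum => j _; apply: lowered_scale; apply: lowered_pow.
by apply; rewrite gtn_eqF // (leq_trans lt_kl) // leq_addl.
Qed.

(* The coefficient a_n of z^(-n-1) in the vertex operator.  On (q, mu), where
   h_0 acts as q / sqrt (2 m), z^(sqrt (2 m) h_0) is z^q; hence the coefficients
   j and l of the two exponentials contribute when j - l + q = - n - 1.  By
   annihilation_coef_eq0, the terms with l > weight mu vanish. *)
Definition mode (n : int) : fock -> fock :=
  lin_ext (fun k : fock_index =>
    \sum_(l < (weight k.2).+1)
      match l%:Z - k.1 - n - 1 with
      | Posz j => creation_coef j (annihilation_coef l (shift << k >>))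
      | Negz _ => 0
      end).

HB.instance Definition _ (n : int) :=
  GRing.Linear.copy (mode n) (lin_ext _).

Lemma shiftU (k : fock_index) :
  shift << k >> = << (k.1 + (2 * m)%:Z, k.2) : fock_index >>.
Proof. exact: lin_extU. Qed.

Lemma heisU (i : int) (k : fock_index) : heis i << k >> = match i with
    | Posz 0 => (k.1%:~R / alpha) *: << k >>
    | Posz j.+1 =>
        (j.+1 * k.2 j)%:R *: << (k.1, divcm k.2 (ucm j)) : fock_index >>
    | Negz j => << (k.1, mulcm k.2 (ucm j)) : fock_index >>
    end.
Proof. exact: lin_extU. Qed.

Lemma heis_comm (i j : int) (x : fock) :
  heis i (heis j x) - heis j (heis i x) = (i *+ (i + j == 0))%:~R *: x.
Proof.
have divK (u : nat) (mu : {cmonom nat}) : divcm (mulcm mu (ucm u)) (ucm u) = mu.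
  by apply/eqP/cmP => v; rewrite divcmE mulcmE addnK.
have mulAC (u v : nat) (mu : {cmonom nat}) :
    mulcm (mulcm mu (ucm u)) (ucm v) = mulcm (mulcm mu (ucm v)) (ucm u).
  by apply/eqP/cmP => w; rewrite !mulcmE addnAC.
have divAC (u v : nat) (mu : {cmonom nat}) :
    divcm (divcm mu (ucm u)) (ucm v) = divcm (divcm mu (ucm v)) (ucm u).
  by apply/eqP/cmP => w; rewrite !divcmE subnAC.
have mulDiv (u v : nat) (mu : {cmonom nat}) : u != v ->
    divcm (mulcm mu (ucm u)) (ucm v) = mulcm (divcm mu (ucm v)) (ucm u).
  move=> uv; apply/eqP/cmP => w; rewrite divcmE !mulcmE divcmE !ucmE.
  have [wu|wu] := eqVneq u w; last by rewrite !addn0.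
  by rewrite -wu eq_sym (negPf uv) !subn0.
have divmulK (u : nat) (mu : {cmonom nat}) : (0 < mu u)%N ->
    mulcm (divcm mu (ucm u)) (ucm u) = mu.
  move=> mu_gt0; apply/eqP/cmP => w; rewrite mulcmE divcmE ucmE.
  by case: eqVneq => [<-|_]; rewrite ?subnK // subn0 addn0.
pose coef (l : int) (k : fock_index) : C := match l with
  | Posz 0 => k.1%:~R / alpha | Posz u.+1 => (u.+1 * k.2 u)%:R
  | Negz _ => 1 end.
pose idx (l : int) (k : fock_index) : fock_index := match l with
  | Posz 0 => k | Posz u.+1 => (k.1, divcm k.2 (ucm u))
  | Negz u => (k.1, mulcm k.2 (ucm u)) end.
have heisE l k : heis l << k >> = coef l k *: (<< idx l k >> : fock).
  by rewrite heisU; case: l => [[|u]|u] //=; rewrite scale1r.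
have posneg (u v : nat) (k : fock_index) (B : fock_index -> fock) :
    coef (Negz v) k * coef u.+1 (idx (Negz v) k)
      *: B (idx u.+1 (idx (Negz v) k))
    - coef u.+1 k * coef (Negz v) (idx u.+1 k) *: B (idx (Negz v) (idx u.+1 k))
    = (Posz u.+1 *+ (Posz u.+1 + Negz v == 0))%:~R *: B k.
  case: k => q mu; rewrite /= mulcmE ucmE mul1r mulr1.
  have -> : (Posz u.+1 + Negz v == 0) = (v == u).
    by rewrite NegzE subr_eq0 eqz_nat eqSS eq_sym.
  have [->|vu] := eqVneq v u; last first.
    by rewrite addn0 mulDiv // subrr scale0r.
  rewrite divK; have [mu0|mu_gt0] := posnP (mu u).
    by rewrite mu0 muln0 scale0r subr0 add0n muln1.
  by rewrite divmulK // -scalerBl mulnDr natrD muln1 addrAC subrr add0r.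
have basis k : heis i (heis j << k >>) - heis j (heis i << k >>)
    = (i *+ (i + j == 0))%:~R *: (<< k >> : fock).
  rewrite (heisE j k) (heisE i k).
  rewrite [heis i (_ *: _)]linearZ [heis j (_ *: _)]linearZ /=.
  rewrite (heisE i (idx j k)) (heisE j (idx i k)) !scalerA.
  have [B BE] : exists B : fock_index -> fock, forall k', << k' >> = B k'.
    by exists (fun k' => << k' >>).
  rewrite !{}BE.
  case: i => [[|u]|u]; case: j => [[|v]|v].
  - by rewrite subrr mul0rn scale0r.
  - by rewrite /= [_ / _ * _]mulrC subrr scale0r.
  - by rewrite /= mul1r mulr1 subrr scale0r.
  - by rewrite /= [_ / _ * _]mulrC subrr scale0r.
  - case: k => q mu; rewrite /= !divcmE !ucmE (divAC u v) scale0r.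
    have [->|uv] := eqVneq u v; first by rewrite subrr.
    by rewrite !subn0 [X in X *: _ - _]mulrC subrr.
  - exact: posneg.
  - by rewrite /= mul1r mulr1 subrr scale0r.
  - rewrite -[LHS]opprB posneg -scaleNr -mulrNz -mulNrn.
    rewrite [Posz _ + _]addrC; congr (_%:~R *: _).
    have -> : (Negz u + Posz v.+1 == 0) = (u == v).
      by rewrite NegzE addrC subr_eq0 eqz_nat eqSS eq_sym.
    by case: eqP => [->|_]; rewrite ?NegzE.
  - by case: k => q mu; rewrite /= (mulAC u v) mul1r subrr scale0r.
rewrite [x]monalgE; elim/big_rec: _ => [|k y _ IH].
  have heis0 l : heis l 0 = 0 by exact: linear0.
  by rewrite !heis0 subr0 scaler0.
have -> : << x@_k *g k >> = x@_k *: (<< k >> : fock).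
  by apply/malgP => k'; rewrite mcoeffZ !mcoeffU mulrnAr mulr1.
have heisD l c (u v : fock) : heis l (c *: u + v) = c *: heis l u + heis l v.
  exact: linearP.
rewrite !heisD opprD addrACA IH -scalerBr basis.
by rewrite scalerDr !scalerA mulrC.
Qed.

(* v_p = |- p / sqrt (2 m)> *)
Definition vp (p : int) : fock := vac (- p).

Lemma mode_vp_eq0 (p n : int) : p <= n -> mode n (vp p) = 0.
Proof.
move=> le_pn; rewrite /mode lin_extU /weight /= mdom1 big_seq_fset0.
rewrite big_ord1 /= sub0r opprK.
by case pnE: (p - n - 1) => [j|//]; lia.
Qed.

Definition mode_word (p : int) (s : seq int) : fock := foldr mode (vp p) s.

Definition principal (p : int) : fock -> Prop :=
  lin_span (fun x => exists s : seq int,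
    (forall i, i \in s -> i <= p - 1) /\ x = mode_word p s).

Definition mode_image (p N : int) : fock -> Prop :=
  lin_span (fun x => exists (i : int) (v : fock),
    [/\ i <= N, principal p v & x = mode i v]).

Definition admissible (p : int) (s : seq int) : bool :=
  (if s is i1 :: _ then i1 <= p - 1 else true) &&
  sorted (fun i j : int => (2 * m)%:Z <= i - j) s.

Definition last_above (N : int) (s : seq int) : bool :=
  if s is i1 :: s' then N < last i1 s' else true.

End VertexOperator.

(* Main.v *)
From HB Require Import structures.
Require Import Defs.
From mathcomp Require Import all_boot all_order all_algebra.
From mathcomp Require Import reals complex.
From mathcomp Require Import finmap.
From mathcomp.multinomials Require Import monalg.
From mathcomp Require Import zify ring.

Set Implicit Arguments.
Unset Strict Implicit.
Unset Printing Implicit Defensive.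

Import Order.TTheory GRing.Theory Num.Theory.

Local Open Scope ring_scope.

(**
Write E(z) = exp(sqrt(2m) sum_(n>0) h_(-n) z^n / n), with coefficients E_j.
These commute, and E_0 = 1.  Moving the annihilating exponential of the vertex
operator phi to the right past E(w) produces the factor (1 - w/z)^(2m), so that
phi(z_1) ... phi(z_k) v_p is, up to a monomial,
prod_(a<b) (z_a - z_b)^(2m) E(z_1) ... E(z_k) applied to a vacuum whose charge
depends on k and p only.  Put j_a = p - 1 - i_a, counting positions from
a = 0.  The word a_(i_0) ... a_(i_(k-1)) v_p is then a combination of products
of the E_n indexed by j - r, r running over the exponents of
prod (z_a - z_b)^(2m).

For an admissible word, l_a = j_a - 2ma is a weakly increasing sequence of
nonnegative integers, and every such sequence occurs exactly once.  The extreme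
exponent r_a = 2ma has coefficient 1 and contributes E_(l_0) ... E_(l_(k-1)).
Any other r contributes l + d, where d <> 0 transfers mass from earlier
positions to later ones: sum_a xi_a d_a >= 0 for each weakly increasing xi.
Hence sum (l_a + d_a)^2 > sum l_a^2.  This is lemma word_raising.  So the
admissible words are unitriangular with respect to the products
E_(l_0) ... E_(l_(k-1)), ordered by the sum of squares, which is invariant under
permutation of the factors and, on nonnegative sequences with a given sum,
bounded.  Downward induction on it shows that admissible words span
(creation_word_span).  They are free because the products of the E_n are:
the E_n are polynomial generators of C[h_(-1), h_(-2), ...]
(creation_word_dual, then word_free).

The quotient follows by keeping track of the largest part.  Position 0 loses at
most 2m(k - 1), so a word that starts with a_i is a combination of
admissible words whose last index is at most i (word_span).  Conversely, the
modes commute, so an admissible word with last index at most N lies in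
a_i V for some i <= N.  Thus the span of the a_i V, i <= N, has for basis the
admissible words with last index at most N, and the others form a basis of the
quotient.

The argument is carried out over an arbitrary module with operators satisfying
the relations that it uses; the Fock space enters at the end.
*)

(** * Sums over triangles and linear maps *)

Lemma sum_triangleC (V : nmodType) (k : nat) (F : nat -> nat -> V) :
  \sum_(1 <= n < k.+1) \sum_(1 <= t < (k - n).+1) F n t =
  \sum_(1 <= n < k.+1) \sum_(1 <= t < (k - n).+1) F t n.
Proof.
have widen (G : nat -> nat -> V) :
    \sum_(1 <= n < k.+1) \sum_(1 <= t < (k - n).+1) G n t =
    \sum_(1 <= n < k.+1) \sum_(1 <= t < k.+1 | (n + t <= k)%N) G n t.
  apply: eq_big_nat => n /andP[n_gt0 le_nk].
  rewrite (big_nat_widen 1 (k - n).+1 k.+1) ?ltnS ?leq_subr //.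
  by apply: eq_bigl => t /=; lia.
rewrite !widen (exchange_big_dep_nat predT) //=.
by apply: eq_bigr => t _; apply: eq_bigl => n; rewrite addnC.
Qed.

(** The substitution s = n + t. *)
Lemma sum_triangle (V : nmodType) (k : nat) (F : nat -> nat -> V) :
  \sum_(1 <= n < k.+1) \sum_(0 <= t < (k - n).+1) F n t =
  \sum_(1 <= s < k.+1) \sum_(0 <= t < s) F (s - t)%N t.
Proof.
elim: k => [|k IHk]; first by rewrite !big_nil.
rewrite [RHS]big_nat_recr //= -IHk [LHS]big_nat_recr //= subnn big_nat1.
rewrite [X in _ = _ + X]big_nat_recl // subn0 addrA [RHS]addrAC.
congr (_ + _); have -> : \sum_(0 <= t < k) F (k.+1 - t.+1)%N t.+1 =
    \sum_(1 <= n < k.+1) F n (k.+1 - n)%N.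
  rewrite [RHS]big_nat_rev /= big_add1; apply: eq_big_nat => t ltk /=.
  by congr (F _ _); lia.
rewrite -big_split /=; apply: eq_big_nat => n /andP[n_gt0 le_nk].
by rewrite subSn // big_nat_recr.
Qed.

Section LinearMaps.
Variables (F : fieldType) (U V : lmodType F) (f : U -> V).
Hypothesis f_lin : linear f.

Let g : {linear U -> V} := HB.pack f (GRing.isLinear.Build F U V _ f f_lin).

Lemma lin0 : f 0 = 0. Proof. exact: (linear0 g). Qed.

Lemma linZ c x : f (c *: x) = c *: f x. Proof. exact: (linearZ_LR g). Qed.

Lemma linB : {morph f : x y / x - y}. Proof. exact: (linearB g). Qed.

Lemma lin_sum I (r : seq I) P (G : I -> U) :
  f (\sum_(i <- r | P i) G i) = \sum_(i <- r | P i) f (G i).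
Proof. exact: (linear_sum g). Qed.
End LinearMaps.

(** * Exponentials of series of commuting operators *)

Section Exponential.
Variables (F : numFieldType) (V : lmodType F) (A : nat -> V -> V).
Hypothesis A_lin : forall n, linear (A n).
Hypothesis A_comm : forall n n' x, A n (A n' x) = A n' (A n x).

Let pow : nat -> nat -> V -> V := pow_coef A.
Let ex : nat -> V -> V := exp_coef A.

Lemma pow_coef_lin j k : linear (pow j k).
Proof.
elim: j k => [|j IHj] k c x y; rewrite /pow /=.
  by case: eqP => // _; rewrite scaler0 addr0.
rewrite scaler_sumr -big_split /=; apply: eq_bigr => n _.
by rewrite [pow_coef _ _ _ _]IHj A_lin.
Qed.

Lemma exp_coef_lin k : linear (ex k).
Proof.
move=> c x y; rewrite /ex /exp_coef scaler_sumr -big_split /=.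
apply: eq_bigr => j _; rewrite [pow_coef _ _ _ _]pow_coef_lin.
by rewrite scalerDr !scalerA mulrC.
Qed.

Lemma pow_coef_comm (B : V -> V) :
  linear B ->
  (forall n x, B (A n x) = A n (B x)) ->
  forall j k x, B (pow j k x) = pow j k (B x).
Proof.
move=> Blin BA; elim=> [|j IHj] k x; rewrite /pow /=.
  by case: eqP => // _; rewrite (lin0 Blin).
rewrite (lin_sum Blin); apply: eq_bigr => n _.
by rewrite BA [B (pow_coef _ _ _ _)]IHj.
Qed.

Lemma exp_coef_comm (B : V -> V) :
  linear B ->
  (forall n x, B (A n x) = A n (B x)) ->
  forall k x, B (ex k x) = ex k (B x).
Proof.
move=> Blin BA k x; rewrite /ex /exp_coef (lin_sum Blin); apply: eq_bigr => j _.
by rewrite (linZ Blin) [B _](pow_coef_comm Blin BA).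
Qed.

Lemma exp_coef0 x : ex 0 x = x.
Proof. by rewrite /ex /exp_coef big_ord1 /= invr1 scale1r. Qed.

Lemma exp_coefEw k b x : (k < b)%N ->
  ex k x = \sum_(0 <= j < b) (j`!%:R)^-1 *: pow j k x.
Proof.
move=> lt_kb; rewrite (big_cat_nat (n := k.+1)) //= [X in _ + X]big_nat [X in _ + X]big1.
  by rewrite addr0 big_mkord.
move=> j /andP[lt_kj _]; rewrite [pow _ _ _]pow_coef_eq0 ?scaler0 // => n.
exact: lin0.
Qed.

(** The coefficient of z^k in z (A^(j+1))' = (j + 1) (z A') A^j. *)
Lemma pow_coefS j k x :
  k%:R *: pow j.+1 k x =
  j.+1%:R *: \sum_(1 <= n < k.+1) n%:R *: A n (pow j (k - n) x).
Proof.
elim: j k => [|j IHj] k.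
  rewrite scale1r [pow 1 k x]/pow /= scaler_sumr; apply: eq_big_nat => n.
  move=> /andP[_ le_nk]; rewrite [in RHS]/pow /=; case: eqP => [kn|_].
    by have -> : n = k by lia.
  by rewrite (lin0 (A_lin _)) !scaler0.
rewrite [pow j.+2 k x]/pow [pow_coef]lock /= -lock scaler_sumr.
transitivity (\sum_(1 <= n < k.+1) n%:R *: A n (pow j.+1 (k - n) x) +
    \sum_(1 <= n < k.+1) A n ((k - n)%:R *: pow j.+1 (k - n) x)).
  rewrite -big_split /=; apply: eq_big_nat => n /andP[_ le_nk].
  by rewrite (linZ (A_lin _)) -scalerDl -natrD subnKC.
rewrite [j.+2%:R]mulrS scalerDl scale1r; congr (_ + _).
transitivity (j.+1%:R *: \sum_(1 <= n < k.+1) \sum_(1 <= n' < (k - n).+1)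
    n'%:R *: A n (A n' (pow j (k - n - n') x))).
  rewrite scaler_sumr; apply: eq_bigr => n _; rewrite IHj (linZ (A_lin _)).
  congr (_ *: _); rewrite (lin_sum (A_lin _)).
  by apply: eq_bigr => n' _; rewrite (linZ (A_lin _)).
congr (_ *: _); rewrite sum_triangleC; apply: eq_bigr => n _.
rewrite [pow j.+1 _ x]/pow /= (lin_sum (A_lin _)) scaler_sumr.
by apply: eq_bigr => n' _; rewrite A_comm subnAC.
Qed.

(** The coefficient of z^k in z (exp A)' = (z A') exp A.  This recurrence
determines the exponential, and later proofs use it in place of the
definition. *)
Lemma exp_coefS k x :
  k%:R *: ex k x = \sum_(1 <= n < k.+1) n%:R *: A n (ex (k - n) x).
Proof.
rewrite (exp_coefEw (b := k.+2)) // big_nat_recl // scalerDr.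
have -> : k%:R *: (0`!%:R^-1 *: pow 0 k x) = 0.
  rewrite [pow 0 k x]/pow /=; case: eqP => [->|_]; last by rewrite !scaler0.
  by rewrite scale0r.
rewrite add0r scaler_sumr.
transitivity (\sum_(0 <= j < k.+1) \sum_(1 <= n < k.+1)
    (n%:R * j`!%:R^-1) *: A n (pow j (k - n) x)).
  apply: eq_bigr => j _; rewrite scalerA mulrC -scalerA pow_coefS scalerA.
  rewrite scaler_sumr; apply: eq_bigr => n _; rewrite scalerA; congr (_ *: _).
  have j1_neq0 : j.+1%:R != 0 :> F by rewrite pnatr_eq0.
  have jf_neq0 : j`!%:R != 0 :> F by rewrite pnatr_eq0 -lt0n fact_gt0.
  rewrite factS natrM; field; rewrite jf_neq0 nat1r.
  exact: j1_neq0.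
rewrite exchange_big_nat; apply: eq_big_nat => n /andP[_ le_nk].
rewrite (exp_coefEw (b := k.+1)) ?ltnS ?leq_subr // (lin_sum (A_lin _)) scaler_sumr.
by apply: eq_bigr => j _; rewrite (linZ (A_lin _)) scalerA.
Qed.

End Exponential.

(** * The two exponentials of a vertex operator *)

Section HeisenbergModule.
Variables (F : numFieldType) (V : lmodType F) (alpha : F) (h : int -> V -> V).
Hypothesis heis_lin : forall i, linear (h i).
Hypothesis heis_comm : forall i j x,
  h i (h j x) - h j (h i x) = (i *+ (i + j == 0))%:~R *: x.

Lemma heis0r i : h i 0 = 0. Proof. exact: lin0. Qed.
Lemma heisB i : {morph h i : x y / x - y}. Proof. exact: linB. Qed.
Lemma heisZ i c x : h i (c *: x) = c *: h i x. Proof. exact: linZ. Qed.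
Lemma heis_sum i I (r : seq I) P (A : I -> V) :
  h i (\sum_(k <- r | P k) A k) = \sum_(k <- r | P k) h i (A k).
Proof. exact: lin_sum. Qed.

Lemma heisC i j (x : V) : i + j != 0 -> h i (h j x) = h j (h i x).
Proof.
move=> ij; apply/eqP; rewrite -subr_eq0 heis_comm.
by rewrite (negPf ij) scale0r.
Qed.

Lemma heis_oppC a b (x : V) :
  h (- a%:Z) (h (- b%:Z) x) = h (- b%:Z) (h (- a%:Z) x).
Proof.
have [/eqP ab|] := boolP (- a%:Z + - b%:Z == 0); last exact: heisC.
by have [-> ->] : a = 0%N /\ b = 0%N by lia.
Qed.

Lemma heis_natC (a b : nat) (x : V) : h a (h b x) = h b (h a x).
Proof.
have [/eqP ab|] := boolP (a%:Z + b%:Z == 0); last exact: heisC.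
by have [-> ->] : a = 0%N /\ b = 0%N by lia.
Qed.

Let Ecoef n (x : V) := (alpha / n%:R) *: h (- n%:Z) x.
Let Gcoef n (x : V) := - (alpha / n%:R) *: h n%:Z x.

Let Ecoef_lin n : linear (Ecoef n).
Proof.
by move=> c x y; rewrite /Ecoef heis_lin scalerDr !scalerA mulrC.
Qed.

Let Gcoef_lin n : linear (Gcoef n).
Proof.
by move=> c x y; rewrite /Gcoef heis_lin scalerDr !scalerA mulrC.
Qed.

Let Ecoef_comm n n' x : Ecoef n (Ecoef n' x) = Ecoef n' (Ecoef n x).
Proof. by rewrite /Ecoef !heisZ heis_oppC !scalerA mulrC. Qed.

Let Gcoef_comm n n' x : Gcoef n (Gcoef n' x) = Gcoef n' (Gcoef n x).
Proof. by rewrite /Gcoef !heisZ heis_natC !scalerA mulrC. Qed.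

(** The coefficient of z^j in exp (alpha sum_(n>0) h_(-n) z^n / n), for any
integer j, so that differences of indices need no case distinction. *)
Definition creation (j : int) (x : V) : V :=
  if j is Posz j' then
    exp_coef (fun n y => (alpha / n%:R) *: h (- n%:Z) y) j' x
  else 0.

(** The coefficient of z^(-l) in exp (- alpha sum_(n>0) h_n z^(-n) / n). *)
Definition annihilation : nat -> V -> V :=
  exp_coef (fun n y => - (alpha / n%:R) *: h n%:Z y).

Notation E := creation.
Notation G := annihilation.

Lemma creation_lin j : linear (E j).
Proof.
case: j => [j|j] c x y /=; last by rewrite scaler0 addr0.
exact: (exp_coef_lin Ecoef_lin).
Qed.

Lemma creation0r j : E j 0 = 0. Proof. exact/lin0/creation_lin. Qed.
Lemma creationB j : {morph E j : x y / x - y}. Proof. exact/linB/creation_lin. Qed.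
Lemma creationZ j c x : E j (c *: x) = c *: E j x. Proof. exact/linZ/creation_lin. Qed.

Lemma creation0 x : E 0 x = x.
Proof. exact: (exp_coef0 Ecoef). Qed.

Lemma annihilation0 x : G 0 x = x.
Proof. exact: (exp_coef0 Gcoef). Qed.

Lemma creation_lt0 j x : j < 0 -> E j x = 0.
Proof. by case: j. Qed.

Lemma creation_heis j n x : E j (h (Negz n) x) = h (Negz n) (E j x).
Proof.
case: j => [j|j] /=; last by rewrite heis0r.
apply: esym; apply: (exp_coef_comm (A := Ecoef) (heis_lin (Negz n))) => k y.
by rewrite /Ecoef heisZ NegzE heis_oppC.
Qed.

Lemma creation_comm i j x : E i (E j x) = E j (E i x).
Proof.
case: j => [j|j]; last by rewrite creation0r.
have Ecoef0 y : Ecoef 0 y = 0.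
  have a0 : alpha / 0%:R = 0 by rewrite mulr0n invr0 mulr0.
  by rewrite /Ecoef a0 scale0r.
apply: (exp_coef_comm (A := Ecoef) (creation_lin i)) => -[|k] y.
  by rewrite !Ecoef0 creation0r.
rewrite /Ecoef creationZ; congr (_ *: _).
by rewrite -NegzE creation_heis.
Qed.

Lemma creation_rec (j : nat) x :
  j%:R *: E j x = alpha *: \sum_(1 <= n < j.+1) h (- n%:Z) (E (j - n)%N x).
Proof.
rewrite [LHS](exp_coefS Ecoef_lin Ecoef_comm) scaler_sumr.
apply: eq_big_nat => n /andP[n_gt0 _]; rewrite scalerA mulrC divfK //.
by rewrite pnatr_eq0 -lt0n.
Qed.

Lemma annihilation_rec (l : nat) x :
  l%:R *: G l x = - alpha *: \sum_(1 <= n < l.+1) h n%:Z (G (l - n)%N x).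
Proof.
rewrite [LHS](exp_coefS Gcoef_lin Gcoef_comm) scaler_sumr.
apply: eq_big_nat => n /andP[n_gt0 _]; rewrite scalerA mulrC mulNr divfK //.
by rewrite pnatr_eq0 -lt0n.
Qed.

(** The annihilating exponential conjugates h_(-n) to h_(-n) - alpha z^(-n),
because [h_k, h_(-n)] is the scalar k when k = n and 0 otherwise.  The index
Negz n below stands for -(n + 1). *)
Lemma annihilation_heis l n x :
  G l (h (Negz n) x) =
  h (Negz n) (G l x) - (if (n < l)%N then alpha *: G (l - n.+1) x else 0).
Proof.
elim/ltn_ind: l => l IHl; have [->|l_gt0] := posnP l.
  by rewrite !annihilation0 subr0.
have l_neq0 : l%:R != 0 :> F by rewrite pnatr_eq0 -lt0n.
apply: (scalerI l_neq0); rewrite annihilation_rec.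
pose D k := if (n < l - k)%N then alpha *: G (l - k - n.+1) x else 0.
transitivity (- alpha *: \sum_(1 <= k < l.+1)
   (h (Negz n) (h k%:Z (G (l - k) x)) - h k%:Z (D k)
    + (if k == n.+1 then k%:R *: G (l - k) x else 0))).
  congr (_ *: _); apply: eq_big_nat => k /andP[k_gt0 le_kl].
  rewrite IHl; last by lia.
  rewrite heisB addrAC; congr (_ - _); apply/eqP.
  rewrite addrC -subr_eq heis_comm; apply/eqP.
  have -> : (k%:Z + Negz n == 0) = (k == n.+1) by lia.
  by case: eqP => _; rewrite ?mulr0n ?scale0r ?mulr1n ?pmulrn.
rewrite big_split big_split sumrN /=.
have -> : \sum_(1 <= k < l.+1) h (Negz n) (h k%:Z (G (l - k) x)) =
    h (Negz n) (\sum_(1 <= k < l.+1) h k%:Z (G (l - k) x)).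
  by rewrite heis_sum.
rewrite scalerDr scalerBr -[X in X - _ + _]heisZ -annihilation_rec heisZ.
rewrite scalerBr -!addrA; congr (_ + _).
rewrite /D; case: ifP => [lt_nl|le_ln]; last first.
  rewrite scaler0 oppr0 [X in _ + _ *: X]big_nat [X in _ + _ *: X]big1; last first.
    by move=> k /andP[k_gt0 lt_kl]; case: eqP => //; lia.
  rewrite big_nat big1 ?scaler0 ?subr0 ?addr0 ?oppr0 // => k /andP[k_gt0 lt_kl].
  by case: ifP; [lia | rewrite heis0r].
have -> : \sum_(1 <= k < l.+1) (if k == n.+1 then k%:R *: G (l - k) x else 0)
    = n.+1%:R *: G (l - n.+1) x.
  rewrite (big_cat_nat (n := n.+1)) //=; last by lia.
  rewrite big_nat big1 ?add0r; last by move=> k /andP[_ ?]; case: eqP => //; lia.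
  rewrite big_ltn ?eqxx; last by lia.
  rewrite big_nat big1 ?addr0 // => k /andP[? _]; case: eqP => //; lia.
have -> : \sum_(1 <= k < l.+1) h k%:Z
      (if (n < l - k)%N then alpha *: G (l - k - n.+1) x else 0)
    = alpha *: \sum_(1 <= k < (l - n.+1).+1) h k%:Z (G (l - n.+1 - k)%N x).
  rewrite (big_cat_nat (n := (l - n.+1).+1)) //=; last by lia.
  rewrite [X in _ + X]big_nat [X in _ + X]big1 ?addr0; last first.
    by move=> k /andP[? ?]; case: ifP; [lia | rewrite heis0r].
  rewrite scaler_sumr; apply: eq_big_nat => k /andP[? ?].
  rewrite ifT ?heisZ; last by lia.
  by congr (_ *: h _ (G _ _)); lia.
have -> : - alpha *: (alpha *: \sum_(1 <= k < (l - n.+1).+1)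
      h k%:Z (G (l - n.+1 - k)%N x)) =
    alpha *: ((l - n.+1)%:R *: G (l - n.+1) x).
  by rewrite annihilation_rec !scalerA mulrC.
rewrite !scalerA -!scaleNr -scalerDl natrB //; congr (_ *: _).
by ring.
Qed.

(** Summed against the creation coefficients, the correction in
annihilation_heis is the same sum with c shifted by n: this is
[phi(z), h_(-n)] = - alpha z^(-n) phi(z), on a vector where the sum over l may
be truncated. *)
Lemma vertex_sum_heis (c : int) b n x : (0 < n)%N ->
  \sum_(0 <= l < b + n) E (l%:Z + c) (G l (h (- n%:Z) x)) =
  h (- n%:Z) (\sum_(0 <= l < b + n) E (l%:Z + c) (G l x)) -
  alpha *: \sum_(0 <= l < b) E (l%:Z + (c + n%:Z)) (G l x).
Proof.
case: n => // n _; rewrite -NegzE heis_sum.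
have step l : E (l%:Z + c) (G l (h (Negz n) x)) =
    h (Negz n) (E (l%:Z + c) (G l x)) -
    (if (n < l)%N then alpha *: E (l%:Z + c) (G (l - n.+1) x) else 0).
  rewrite annihilation_heis creationB creation_heis; congr (_ - _).
  by case: ifP => _; rewrite ?creationZ ?creation0r.
under eq_bigr do rewrite step; rewrite sumrB; congr (_ - _).
rewrite (big_cat_nat (n := n.+1)) //=; last exact: leq_addl.
rewrite big_nat big1 ?add0r; last first.
  by move=> l /andP[_ lt_ln]; rewrite ltnNge -ltnS lt_ln.
rewrite -{1}[n.+1]add0n big_addn addnK scaler_sumr; apply: eq_bigr => l _.
by rewrite ifT ?addnK; [congr (_ *: E _ _); lia | lia].
Qed.

End HeisenbergModule.

(** * Commutation of the modes *)

Lemma sum_triangle_exchange (V : nmodType) (k : nat) (A : nat -> nat -> V) :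
  \sum_(1 <= n < k.+1) \sum_(0 <= t < (k - n).+1) A n t =
  \sum_(0 <= t < k.+1) \sum_(1 <= n < (k - t).+1) A n t.
Proof.
transitivity (\sum_(1 <= n < k.+1) \sum_(0 <= t < k.+1 | (n + t <= k)%N) A n t).
  apply: eq_big_nat => n /andP[n_gt0 le_nk].
  rewrite (big_nat_widen 0 (k - n).+1 k.+1) ?ltnS ?leq_subr //.
  by apply: eq_bigl => t /=; lia.
rewrite (exchange_big_dep_nat predT) //=; apply: eq_big_nat => t /andP[_ le_tk].
rewrite (big_nat_widen 1 (k - t).+1 k.+1) ?ltnS ?leq_subr //.
by apply: eq_bigl => n /=; lia.
Qed.

(** The coefficient of x^t in (1 - x)^n. *)
Definition signed_bin (R : pzRingType) (n t : nat) : R := (-1) ^+ t * 'C(n, t)%:R.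

Lemma sum_signed_bin (R : comRingType) (n s : nat) :
  \sum_(0 <= t < s.+1) signed_bin R n.+1 t = (-1) ^+ s * 'C(n, s)%:R.
Proof.
elim: s => [|s IHs]; first by rewrite big_nat1 /signed_bin !bin0.
rewrite big_nat_recr //= IHs /signed_bin binS natrD exprS; ring.
Qed.

(** The coefficient of x^s in x f' = - n x f / (1 - x), for f = (1 - x)^n. *)
Lemma signed_bin_rec (R : comRingType) (n s : nat) :
  s%:R * signed_bin R n s = - (n%:R * \sum_(0 <= t < s) signed_bin R n t).
Proof.
case: s => [|s]; first by rewrite big_nil mulr0 oppr0 mul0r.
case: n => [|n]; first by rewrite /signed_bin bin0n mulr0 mulr0 mul0r oppr0.
rewrite sum_signed_bin /signed_bin mulrCA -natrM -mul_bin_diag natrM exprS /=; ring.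
Qed.

Section VertexOperator.
Variables (F : numFieldType) (V : lmodType F) (alpha : F) (h : int -> V -> V).
Hypothesis heis_lin : forall i, linear (h i).
Hypothesis heis_comm : forall i j x,
  h i (h j x) - h j (h i x) = (i *+ (i + j == 0))%:~R *: x.
Variables (m : nat) (vac : int -> V) (mode : int -> V -> V).
Hypothesis alpha_sqr : alpha * alpha = (2 * m)%:R.
Hypothesis mode_lin : forall n, linear (mode n).
Hypothesis mode_heis : forall n j x, (0 < j)%N ->
  mode n (h (- j%:Z) x) = h (- j%:Z) (mode n x) - alpha *: mode (n - j%:Z) x.
Notation E := (creation alpha h).
Hypothesis mode_vac : forall n q,
  mode n (vac q) = E (- q - n - 1) (vac (q + (2 * m)%:Z)).
Hypothesis vac_generates : forall P : V -> Prop,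
  (forall c x y, P x -> P y -> P (c *: x + y)) -> (forall q, P (vac q)) ->
  (forall j x, (0 < j)%N -> P x -> P (h (- j%:Z) x)) -> forall x, P x.

Notation b := (signed_bin F (2 * m)).
Let creation_lin := creation_lin alpha heis_lin.

(** The relation phi(z) E(w) = (1 - w/z)^(2m) E(w) phi(z).  The recurrence for
E_j reduces it to the commutator of the modes with the h_(-n); since
alpha^2 = 2m, the correction terms obey the recurrence for (1 - x)^(2m). *)
Lemma mode_creation_nat n (j : nat) x :
  mode n (E j x) =
  \sum_(0 <= t < j.+1) b t *: E (j - t)%N (mode (n - t%:Z) x).
Proof.
elim/ltn_ind: j n x => j IHj n x; have [->|j_gt0] := posnP j.
  by rewrite big_nat1 subr0 !creation0 /signed_bin bin0 mul1r scale1r.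
have j_neq0 : j%:R != 0 :> F by rewrite pnatr_eq0 -lt0n.
apply: (scalerI j_neq0); rewrite -(linZ (mode_lin n)) creation_rec //.
rewrite (linZ (mode_lin n)) (lin_sum (mode_lin n)).
have -> : \sum_(1 <= k < j.+1) mode n (h (- k%:Z) (E (j - k)%N x)) =
    \sum_(1 <= k < j.+1) (\sum_(0 <= t < (j - k).+1)
      b t *: h (- k%:Z) (E (j - k - t)%N (mode (n - t%:Z) x)) -
    alpha *: \sum_(0 <= t < (j - k).+1)
      b t *: E (j - k - t)%N (mode (n - k%:Z - t%:Z) x)).
  apply: eq_big_nat => k /andP[k_gt0 le_kj].
  rewrite mode_heis // !IHj; [|lia..].
  rewrite (lin_sum (heis_lin _)); congr (_ - _).
  by apply: eq_bigr => t _; rewrite (linZ (heis_lin _)).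
rewrite sumrB -scaler_sumr scalerBr scalerA alpha_sqr.
rewrite sum_triangle_exchange.
rewrite (sum_triangle _ (fun k t =>
  b t *: E (j - k - t)%N (mode (n - k%:Z - t%:Z) x))).
pose X t := E (j - t)%N (mode (n - t%:Z) x).
have -> : \sum_(1 <= s < j.+1) \sum_(0 <= t < s)
     b t *: E (j - (s - t) - t)%N (mode (n - (s - t)%N%:Z - t%:Z) x) =
   \sum_(0 <= s < j.+1) (\sum_(0 <= t < s) b t) *: X s.
  rewrite [RHS]big_ltn // big_nil scale0r add0r; apply: eq_bigr => s _.
  rewrite scaler_suml; apply: eq_big_nat => t /andP[_ lt_ts]; rewrite /X.
  by congr (_ *: E _ (mode _ _)); lia.
have -> : alpha *: \sum_(0 <= t < j.+1) \sum_(1 <= k < (j - t).+1)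
     b t *: h (- k%:Z) (E (j - k - t)%N (mode (n - t%:Z) x)) =
   \sum_(0 <= t < j.+1) ((j - t)%:R * b t) *: X t.
  rewrite scaler_sumr; apply: eq_bigr => t _.
  rewrite -scaler_sumr [LHS]scalerA [alpha * _]mulrC -[LHS]scalerA.
  rewrite [_%:R * b t]mulrC.
  rewrite -[RHS]scalerA /X creation_rec //.
  congr (_ *: (_ *: _)); apply: eq_bigr => k _.
  by rewrite subnAC.
rewrite !scaler_sumr -sumrB; apply: eq_big_nat => s /andP[_ le_sj].
rewrite !scalerA -scalerBl; congr (_ *: _); rewrite natrB // mulrBl.
by rewrite signed_bin_rec opprK addrK.
Qed.

(** Unlike in mode_creation_nat, the range is the support of the coefficients
of (1 - x)^(2m): this is where the exponent 2m being a natural number matters,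
and it bounds all shifts of indices from now on. *)
Lemma mode_creation n j x :
  mode n (E j x) =
  \sum_(0 <= t < (2 * m).+1) b t *: E (j - t%:Z) (mode (n - t%:Z) x).
Proof.
case: j => [j|j]; last first.
  rewrite [E _ x]/= (lin0 (mode_lin n)) big1 // => t _.
  by rewrite creation_lt0 ?scaler0 //; lia.
rewrite mode_creation_nat; pose B := (maxn j (2 * m)).+1.
have tail k : (k < B)%N -> (forall t, (k < t)%N ->
    b t *: E (j%:Z - t%:Z) (mode (n - t%:Z) x) = 0) ->
  \sum_(0 <= t < k.+1) b t *: E (j%:Z - t%:Z) (mode (n - t%:Z) x) =
  \sum_(0 <= t < B) b t *: E (j%:Z - t%:Z) (mode (n - t%:Z) x).
  move=> lt_kB t0; rewrite [RHS](big_cat_nat (n := k.+1)) //=.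
  by rewrite [X in _ + X]big_nat [X in _ + X]big1 ?addr0 // => t /andP[/t0].
rewrite [RHS]tail; last first.
- by move=> t lt_mt; rewrite /signed_bin bin_small // mulr0 scale0r.
- by rewrite /B; lia.
rewrite -(tail j); last first.
- by move=> t lt_jt; rewrite creation_lt0 ?scaler0 //; lia.
- by rewrite /B; lia.
by apply: eq_big_nat => t /andP[_ ?]; rewrite subzn.
Qed.

(** Commutators with the h_(-n) reduce the claim to the vacuum vectors, on which
phi(z) phi(w) is (z - w)^(2m) times an expression symmetric in z and w; the
exponent is even, so the substitution t -> 2m - t exchanges the two sides. *)
Lemma mode_comm n n' x : mode n (mode n' x) = mode n' (mode n x).
Proof.
elim/vac_generates: x n n' => [c x y IHx IHy|q|j x j_gt0 IHx] n n'.
- by rewrite !mode_lin IHx IHy.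
- rewrite !mode_vac !mode_creation.
  (* t -> 2m - t on the left-hand side *)
  rewrite big_nat_rev /= add0n; apply: eq_big_nat => t /andP[_ lt_tm].
  rewrite !mode_vac creation_comm //; congr (_ *: _).
    rewrite /signed_bin subSS bin_sub; last by rewrite -ltnS.
    by rewrite -signr_odd oddB // oddM /= signr_odd.
  by congr (E _ (E _ _)); lia.
have step k k' : mode k (mode k' (h (- j%:Z) x)) =
    h (- j%:Z) (mode k (mode k' x)) - alpha *: mode (k - j%:Z) (mode k' x) -
    alpha *: mode k (mode (k' - j%:Z) x).
  by rewrite mode_heis // linB // (linZ (mode_lin _)) mode_heis.
rewrite !step (IHx n n') (IHx (n - j%:Z) n') (IHx n (n' - j%:Z)).
by rewrite -!addrA; congr (_ + _); rewrite addrC.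
Qed.

End VertexOperator.

(** * Spans, sequences and folds *)

Section Span.
Variables (F : fieldType) (V : lmodType F).
Implicit Types (S T : V -> Prop) (x y : V).

Lemma span_mem S x : S x -> lin_span S x.
Proof.
move=> Sx; exists [:: (1, x)]; split; last by rewrite big_seq1 scale1r.
by move=> t; rewrite inE => /eqP ->.
Qed.

Lemma span0 S : lin_span S 0.
Proof. by exists [::]; rewrite big_nil. Qed.

Lemma spanZD S c x y : lin_span S x -> lin_span S y -> lin_span S (c *: x + y).
Proof.
move=> [r [Sr ->]] [s [Ss ->]].
exists ([seq (c * t.1, t.2) | t <- r] ++ s); split.
  by move=> t; rewrite mem_cat => /orP[/mapP[u /Sr ? ->]|/Ss].
rewrite big_cat big_map scaler_sumr; congr (_ + _).
by apply: eq_bigr => t _; rewrite scalerA.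
Qed.

Lemma spanZ S c x : lin_span S x -> lin_span S (c *: x).
Proof. by move=> Sx; rewrite -[_ *: x]addr0; apply: spanZD (span0 S). Qed.

Lemma spanD S x y : lin_span S x -> lin_span S y -> lin_span S (x + y).
Proof. by move=> Sx; rewrite -[x]scale1r; apply: spanZD. Qed.

Lemma span_ind (P : V -> Prop) S :
  P 0 -> (forall c x y, S x -> P y -> P (c *: x + y)) ->
  forall x, lin_span S x -> P x.
Proof.
move=> P0 PD x [r [Sr ->]]; elim: r Sr => [|t r IHr] Sr; first by rewrite big_nil.
rewrite big_cons; apply: PD; first by apply: Sr; rewrite mem_head.
by apply: IHr => u ur; apply: Sr; rewrite in_cons ur orbT.
Qed.

Lemma span_sub S T : (forall x, S x -> lin_span T x) ->
  forall x, lin_span S x -> lin_span T x.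
Proof.
by move=> sST; apply: span_ind => [|c x y /sST]; [apply: span0|apply: spanZD].
Qed.

Lemma span_sum S I (r : seq I) (P : pred I) (f : I -> V) :
  (forall i, P i -> lin_span S (f i)) -> lin_span S (\sum_(i <- r | P i) f i).
Proof. by move=> Sf; elim/big_ind: _ => //; [apply: span0|apply: spanD]. Qed.

(** Collecting terms of equal index, so that coefficients become a function of
the index. *)
Lemma span_family (I : eqType) (P : I -> Prop) (f : I -> V) x :
  lin_span (fun y => exists2 i, P i & y = f i) x ->
  exists (s : seq I) (c : I -> F),
    [/\ uniq s, forall i, i \in s -> P i & x = \sum_(i <- s) c i *: f i].
Proof.
elim/span_ind: x / => [|a _ y [i Pi ->] [s [c [Us Ps ->]]]].
  by exists [::], (fun=> 0); rewrite big_nil.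
have [is_|is_] := boolP (i \in s).
  exists s, (fun j => (if j == i then a else 0) + c j); split => //.
  under [RHS]eq_bigr do rewrite scalerDl; rewrite big_split; congr (_ + _).
  rewrite (bigD1_seq i) //= eqxx big1 ?addr0 // => j /negPf ->.
  by rewrite scale0r.
exists (i :: s), (fun j => if j == i then a else c j); split.
- by rewrite /= is_.
- by move=> j; rewrite inE => /predU1P[->|/Ps].
- rewrite big_cons eqxx; congr (_ + _); apply: eq_big_seq => j js.
  by case: eqP is_ => // <-; rewrite js.
Qed.

End Span.

Lemma span_map (F : fieldType) (U V : lmodType F) (f : U -> V) S T :
  linear f -> (forall x, S x -> lin_span T (f x)) ->
  forall x, lin_span S x -> lin_span T (f x).
Proof.
move=> f_lin sST; apply: span_ind => [|c x y /sST Tx Ty].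
  by rewrite lin0 //; apply: span0.
by rewrite f_lin; apply: spanZD.
Qed.

Lemma mkseqSl (T : Type) (f : nat -> T) k :
  mkseq f k.+1 = f 0%N :: mkseq (fun a => f a.+1) k.
Proof. by rewrite /mkseq /= (iotaDl 1 0) -map_comp. Qed.

Lemma foldr_comm_perm (I : eqType) (V : Type) (f : I -> V -> V) x s t :
  (forall i j y, f i (f j y) = f j (f i y)) ->
  perm_eq s t -> foldr f x s = foldr f x t.
Proof.
move=> f_comm; move: s t; suff mid s1 s2 s3 :
    foldr f x (s1 ++ s2 ++ s3) = foldr f x (s2 ++ s1 ++ s3).
  move=> s t st; pose P u := foldr f x s = foldr f x u.
  apply: (catCA_perm_ind (P := P) _ st) => //.
  by rewrite /P => s1 s2 s3 ->.
elim: s1 => [//|i s1 IHs] /=; rewrite {}IHs.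
elim: s2 => [//|j s2 IHs] /=; by rewrite f_comm IHs.
Qed.

(** * Raising sequences *)

(** The nonzero sequences of length k that move mass from earlier to later
positions; the second condition expresses this by duality against weakly
increasing sequences.  The last one limits what position 0 loses to the degree
of prod_(a<b) (z_a - z_b)^(2m) in z_0. *)
Definition raising (m k : nat) (d : nat -> int) :=
  [/\ exists2 a, (a < k)%N & d a != 0,
      forall xi : nat -> int,
        (forall a a', (a <= a')%N -> (a' < k)%N -> xi a <= xi a') ->
        0 <= \sum_(0 <= a < k) xi a * d a
    & - (2 * m * k.-1)%N%:Z <= d 0%N].

(** The cross term 2 sum_a l_a d_a is nonnegative by duality with l itself. *)
Lemma raising_norm m k d (l : nat -> int) : raising m k d ->
  (forall a a', (a <= a')%N -> (a' < k)%N -> l a <= l a') ->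
  \sum_(0 <= a < k) l a ^+ 2 < \sum_(0 <= a < k) (l a + d a) ^+ 2.
Proof.
move=> [[a lt_ak da] dual _] /dual le0.
have d2 : 0 < \sum_(0 <= a < k) d a ^+ 2.
  rewrite big_mkord (bigD1 (Ordinal lt_ak)) //=.
  by rewrite ltr_wpDr ?sumr_ge0 // => *; rewrite ?sqr_ge0 ?exprn_even_gt0.
have -> : \sum_(0 <= a < k) (l a + d a) ^+ 2 = \sum_(0 <= a < k) l a ^+ 2 +
    (\sum_(0 <= a < k) l a * d a) *+ 2 + \sum_(0 <= a < k) d a ^+ 2.
  by rewrite -sumrMnl -!big_split; apply: eq_bigr => i _ /=; rewrite sqrrD.
by rewrite -addrA ltrDl ltr_wpDl // mulrn_wge0.
Qed.

(** Duality with the constants 1 and -1. *)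
Lemma raising_sum m k d (l : nat -> int) : raising m k d ->
  \sum_(0 <= a < k) (l a + d a) = \sum_(0 <= a < k) l a.
Proof.
move=> [_ dual _]; rewrite big_split /=.
suff -> : \sum_(0 <= a < k) d a = 0 by rewrite addr0.
apply/eqP; rewrite eq_le.
move: (dual (fun=> 1) (fun _ _ _ _ => lexx _)).
move: (dual (fun=> -1) (fun _ _ _ _ => lexx _)).
under eq_bigr do rewrite mulN1r; rewrite sumrN oppr_ge0 => ->.
by under eq_bigr do rewrite mul1r.
Qed.

(** Duality with the indicator of the last position. *)
Lemma raising_last m k d : raising m k.+1 d -> 0 <= d k.
Proof.
move=> [_ dual _]; have := dual (fun a => (k <= a)%N%:R).
rewrite big_nat_recr //= big_nat big1 ?add0r; last first.
  by move=> a /andP[_ lt_ak]; rewrite leqNgt lt_ak mul0r.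
rewrite leqnn mul1r; apply=> a a' le_aa' _; rewrite ler_nat.
by case: (leqP k a) => // le_ka; rewrite (leq_trans le_ka le_aa').
Qed.

(** One more operator in front takes e_a from the new position 0 for each later
position a.  Summation against xi gains e_a (xi_(a+1) - xi_0) >= 0. *)
Lemma raising_cons m k (d e : nat -> int) :
  (forall xi : nat -> int,
    (forall a a', (a <= a')%N -> (a' < k)%N -> xi a <= xi a') ->
    0 <= \sum_(0 <= a < k) xi a * d a) ->
  (forall a, 0 <= e a) -> \sum_(0 <= a < k) e a <= (2 * m * k)%N%:Z ->
  (exists a, [/\ (a < k)%N, d a != 0 & e a = 0]) \/ 0 < \sum_(0 <= a < k) e a ->
  raising m k.+1
    (fun a => if a is a'.+1 then d a' + e a' else - \sum_(0 <= a < k) e a).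
Proof.
move=> dual e_ge0 e_le ne0; split.
- case: ne0 => [[a [lt_ak da ea]]|e_gt0]; first by exists a.+1; rewrite // ea addr0.
  by exists 0%N; rewrite // oppr_eq0 gt_eqF.
- move=> xi xi_mono; rewrite big_nat_recl //= mulrN mulr_sumr -sumrN -big_split /=.
  under eq_bigr do rewrite mulrDr addrCA [- _ + _]addrC -mulrBl.
  rewrite big_split /= addr_ge0 //.
    by apply: (dual (fun a => xi a.+1)) => a a' ? ?; apply: xi_mono.
  rewrite big_nat sumr_ge0 // => a /andP[_ lt_ak].
  by rewrite mulr_ge0 // subr_ge0; apply: xi_mono.
- by rewrite lerN2.
Qed.

(** * Words in the modes *)

Lemma sum_sqr_le (s : seq int) : all (>= 0) s ->
  \sum_(x <- s) x ^+ 2 <= (\sum_(x <- s) x) ^+ 2.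
Proof.
elim: s => [|x s IHs] /=; first by rewrite !big_nil.
move=> /andP[x_ge0 s_ge0]; rewrite !big_cons sqrrD -addrA lerD2l.
apply: le_trans (IHs s_ge0) _; rewrite lerDr mulrn_wge0 // mulr_ge0 // big_seq.
by apply: sumr_ge0 => y ys; apply: (allP s_ge0).
Qed.

Lemma big_mkseq (V : nmodType) (T : Type) (g : nat -> T) (f : T -> V) k :
  \sum_(x <- mkseq g k) f x = \sum_(0 <= a < k) f (g a).
Proof. by rewrite big_map /index_iota subn0. Qed.

Lemma admissibleE m p s : admissible m p s = (nth (p - 1) s 0 <= p - 1) &&
  sorted (fun i j : int => (2 * m)%:Z <= i - j) s.
Proof. by case: s => //=; rewrite lexx. Qed.

Section Words.
Variables (F : fieldType) (V : lmodType F) (m : nat).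
Variables (vac : int -> V) (E mode : int -> V -> V).
Hypothesis creation_lin : forall j, linear (E j).
Hypothesis creation_comm : forall i j x, E i (E j x) = E j (E i x).
Hypothesis creation_lt0 : forall (j : int) x, j < 0 -> E j x = 0.
Hypothesis mode_lin : forall n, linear (mode n).
Hypothesis mode_comm : forall n n' x, mode n (mode n' x) = mode n' (mode n x).
Hypothesis mode_vac : forall n q,
  mode n (vac q) = E (- q - n - 1) (vac (q + (2 * m)%:Z)).
Hypothesis mode_creation : forall n j x,
  mode n (E j x) = \sum_(0 <= t < (2 * m).+1)
    signed_bin F (2 * m) t *: E (j - t%:Z) (mode (n - t%:Z) x).

(** Negative entries are allowed: they make the vector zero. *)
Definition creation_word (q : int) (mu : seq int) : V := foldr E (vac q) mu.

Lemma creation_word_perm q mu nu :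
  perm_eq mu nu -> creation_word q mu = creation_word q nu.
Proof. exact: foldr_comm_perm. Qed.

Lemma creation_word_lt0 q (mu : seq int) : has (< 0) mu -> creation_word q mu = 0.
Proof.
elim: mu => [//|j mu IHmu] /= /orP[j_lt0|/IHmu ->]; first exact: creation_lt0.
exact: lin0.
Qed.

(** By mode_creation, moving a mode past the factor of index f a lowers this
index by some t <= 2m and raises the index left for the mode by t.  The
extreme choice t = 2m for all factors has coefficient 1; writing t = 2m - e_a,
each other choice is measured by a nonzero e. *)
Lemma mode_creation_word n q k (f : nat -> int) :
  lin_span (fun y => exists e : nat -> int,
     [/\ forall a, 0 <= e a, 0 < \sum_(0 <= a < k) e a,
         \sum_(0 <= a < k) e a <= (2 * m * k)%N%:Z
       & y = creation_word (q + (2 * m)%:Z)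
           (((2 * m * k)%N%:Z - q - n - 1 - \sum_(0 <= a < k) e a) ::
            mkseq (fun a => f a - (2 * m)%:Z + e a) k)])
    (mode n (creation_word q (mkseq f k)) - creation_word (q + (2 * m)%:Z)
       (((2 * m * k)%N%:Z - q - n - 1) ::
        mkseq (fun a => f a - (2 * m)%:Z) k)).
Proof.
elim: k f n => [|k IHk] f n.
  by rewrite /= mode_vac muln0 sub0r subrr; apply: span0.
set T := (T in lin_span T _).
rewrite !mkseqSl /= mode_creation.
set w := creation_word q _; set f' := fun a => f a.+1 in w *.
pose lead t := E (f 0%N - t%:Z) (creation_word (q + (2 * m)%:Z)
  (((2 * m * k)%N%:Z - q - (n - t%:Z) - 1) ::
     mkseq (fun a => f' a - (2 * m)%:Z) k)).
have gen t (e : nat -> int) : (t <= 2 * m)%N -> (forall a, 0 <= e a) ->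
    \sum_(0 <= a < k) e a <= (2 * m * k)%N%:Z ->
    (t < 2 * m)%N || (0 < \sum_(0 <= a < k) e a) ->
    T (E (f 0%N - t%:Z) (creation_word (q + (2 * m)%:Z)
         (((2 * m * k)%N%:Z - q - (n - t%:Z) - 1 - \sum_(0 <= a < k) e a) ::
            mkseq (fun a => f' a - (2 * m)%:Z + e a) k))).
  move=> le_tm e_ge0 e_le ne0.
  (* The index t of mode_creation counts what the factor f 0 loses. *)
  exists (fun a => if a is a'.+1 then e a' else (2 * m - t)%N%:Z).
  rewrite mkseqSl big_nat_recl //=; split; [by case| | |].
  - have : 0 <= \sum_(0 <= a < k) e a by apply: sumr_ge0.
    move: ne0; set Se := \sum_(0 <= a < k) e a => /orP[lt_tm|Se_gt0] Se_ge0; last first.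
      by rewrite ltr_wpDl.
    by rewrite ltr_pwDl //; lia.
  - rewrite mulnSr addrC PoszD; apply: lerD => //; lia.
  - rewrite creation_comm; set Se := \sum_(0 <= a < k) e a.
    by congr (E _ (E _ _)); lia.
(* Up to the span of T, each summand of mode_creation is its extreme term. *)
have near_lead t : (t <= 2 * m)%N ->
    lin_span T (E (f 0%N - t%:Z) (mode (n - t%:Z) w) - lead t).
  move=> le_tm; rewrite /lead -(linB (creation_lin _)).
  apply: (span_map (creation_lin _) _ (IHk f' (n - t%:Z))) => _ [e [e_ge0 e_gt0 e_le ->]].
  by apply: span_mem; apply: gen => //; rewrite e_gt0 orbT.
rewrite big_nat_recr //=.
have -> : signed_bin F (2 * m) (2 * m) = 1.
  by rewrite /signed_bin binn mulr1 -signr_odd oddM.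
rewrite scale1r -[X in lin_span T X]addrA; apply: spanD.
  rewrite big_nat; apply: span_sum => t /andP[_ lt_tm]; apply: spanZ.
  rewrite -[E _ _](subrK (lead t)); apply: spanD; first exact/near_lead/ltnW.
  apply: span_mem; have := gen t (fun=> 0) (ltnW lt_tm) (fun=> lexx _).
  rewrite big1 // subr0 lt_tm => /(_ isT isT); rewrite /lead.
  by under eq_mkseq do rewrite addr0.
suff <- : lead (2 * m)%N = E ((2 * m * k.+1)%N%:Z - q - n - 1)
    (E (f 0%N - (2 * m)%:Z) (foldr E (vac (q + (2 * m)%:Z))
       (mkseq (fun a => f a.+1 - (2 * m)%:Z) k))) by exact: near_lead.
by rewrite /lead /creation_word /= [LHS]creation_comm; congr (E _ _); lia.
Qed.

Variable p : int.
Definition word (s : seq int) : V := foldr mode (vac (- p)) s.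

(** For admissible s, the parts of s form a weakly increasing sequence of
nonnegative integers. *)
Definition part (s : seq int) (a : nat) : int :=
  p - 1 - nth 0 s a - (2 * m * a)%N%:Z.

(** The charge of the vacuum that underlies the words of length k. *)
Definition charge (k : nat) : int := (2 * m * k)%N%:Z - p.

Lemma word_perm s t : perm_eq s t -> word s = word t.
Proof. exact: foldr_comm_perm. Qed.

(** The unitriangularity on which everything rests.  The sequences d depend on
the length of s but not on s: they are the differences between the extreme
exponent of prod_(a<b) (z_a - z_b)^(2m) and the other ones. *)
Lemma word_raising s :
  lin_span (fun y => exists2 d, raising m (size s) d &
      y = creation_word (charge (size s)) (mkseq (fun a => part s a + d a) (size s)))
    (word s - creation_word (charge (size s)) (mkseq (part s) (size s))).
Proof.
elim: s => [|i s IHs].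
  by rewrite /= /charge muln0 sub0r subrr; apply: span0.
rewrite -[word _]/(mode i (word s)) -[size _]/(size s).+1.
set k := size s in IHs *; set T := (T in lin_span T _).
have chargeS : charge k + (2 * m)%:Z = charge k.+1 by rewrite /charge; lia.
have head0 : (2 * m * k)%N%:Z - charge k - i - 1 = part (i :: s) 0.
  by rewrite /charge /part /= muln0; lia.
have step d : (forall xi : nat -> int,
      (forall a a', (a <= a')%N -> (a' < k)%N -> xi a <= xi a') ->
      0 <= \sum_(0 <= a < k) xi a * d a) ->
    lin_span T (mode i (creation_word (charge k) (mkseq (fun a => part s a + d a) k)) -
      creation_word (charge k.+1) (mkseq (fun a => part (i :: s) a +
        (if a is a'.+1 then d a' else 0)) k.+1)).
  move=> dual; have := mode_creation_word i (charge k) k (fun a => part s a + d a).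
  rewrite chargeS head0 => H.
  have -> : mkseq (fun a => part (i :: s) a + (if a is a'.+1 then d a' else 0)) k.+1
     = part (i :: s) 0 :: mkseq (fun a => part s a + d a - (2 * m)%:Z) k.
    rewrite mkseqSl /= addr0; congr (_ :: _); apply: eq_mkseq => a.
    by rewrite /part /=; lia.
  apply: span_sub H => _ [e [e_ge0 e_gt0 e_le ->]]; apply: span_mem.
  eexists; first exact: (raising_cons dual e_ge0 e_le (or_intror e_gt0)).
  rewrite mkseqSl; congr (creation_word _ (_ :: _)); apply: eq_mkseq => a.
  by rewrite /part /=; lia.
rewrite -[mode i _](subrK (mode i (creation_word (charge k) (mkseq (part s) k)))) -addrA.
apply: spanD.
  rewrite -(linB (mode_lin i)).
  apply: (span_map (mode_lin i) _ IHs) => _ [d [d_ne0 dual d_ge] ->].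
  rewrite -[mode i _](subrK (creation_word (charge k.+1)
    (mkseq (fun a => part (i :: s) a + (if a is a'.+1 then d a' else 0)) k.+1))).
  apply: spanD; first exact: step.
  apply: span_mem.
  exists (fun a => if a is a'.+1 then d a' + 0 else - \sum_(0 <= b < k) (0 : int)).
    have [a lt_ak da] := d_ne0.
    apply: raising_cons => //; first by rewrite big1.
    by left; exists a.
  congr (creation_word _ _); apply: eq_mkseq => -[|a]; last by rewrite addr0.
  by rewrite big1.
have := step (fun=> 0).
have -> : mkseq (fun a => part s a + 0) k = mkseq (part s) k.
  by apply: eq_mkseq => a; rewrite addr0.
have -> : mkseq (fun a => part (i :: s) a + (if a is _.+1 then 0 else 0)) k.+1 =
    mkseq (part (i :: s)) k.+1.
  by apply: eq_mkseq => -[|a]; rewrite addr0.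
by apply=> xi _; rewrite big1 // => a _; rewrite mulr0.
Qed.

Definition admissible_word (k : nat) (N : int) (y : V) :=
  exists s, [/\ admissible m p s, size s = k.+1, last 0 s <= N & y = word s].

(** Sort mu; by word_raising the product differs from an admissible word by
products with the same sum of entries and a larger sum of squares, so the
induction is on the gap between the square of the sum and the sum of squares.
The largest entry becomes the last part, which never decreases: this is how
the bound K on an entry turns into a bound on the last index. *)
Lemma creation_word_span k (K : int) (mu : seq int) : size mu = k.+1 -> all (>= 0) mu ->
  has (>= K) mu ->
  lin_span (admissible_word k (p - 1 - K - (2 * m * k)%N%:Z))
    (creation_word (charge k.+1) mu).
Proof.
set T := admissible_word _ _.
(* The gap, which N bounds, is nonnegative on nonnegative sequences. *)
have [N lt_mu] : exists N : nat,
    (\sum_(x <- mu) x) ^+ 2 - \sum_(x <- mu) x ^+ 2 < N%:Z.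
  set c := _ - _; by exists (absz c).+1; lia.
elim: N mu lt_mu => [|N IHN] mu lt_mu size_mu mu_ge0 mu_K.
  by have := sum_sqr_le mu_ge0; lia.
pose r := sort <=%R mu; have r_mu : perm_eq r mu by rewrite perm_sort.
have size_r : size r = k.+1 by rewrite size_sort.
have r_sorted : sorted <=%R r by apply: sort_sorted; apply: le_total.
have [l lE] : exists l : nat -> int, forall a, l a = nth 0 r a.
  by exists (nth 0 r).
have l_mono a a' : (a <= a')%N -> (a' < k.+1)%N -> l a <= l a'.
  move=> le_aa' lt_a'k; rewrite !lE; apply: (sorted_leq_nth le_trans lexx) => //.
  - by rewrite inE size_r (leq_ltn_trans le_aa').
  - by rewrite inE size_r.
have rE : r = mkseq l k.+1 by rewrite (eq_mkseq lE) -size_r mkseq_nth.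
have l_ge0 a : (a < k.+1)%N -> 0 <= l a.
  move=> lt_ak; have : l a \in mu by rewrite lE -(perm_mem r_mu) mem_nth ?size_r.
  exact/allP.
have le_Kl : K <= l k.
  have [x xmu] := hasP mu_K; rewrite -(perm_mem r_mu) in xmu => le_Kx.
  apply: le_trans le_Kx _; rewrite -(nth_index 0 xmu) -lE; apply: l_mono => //.
  by rewrite -ltnS -size_r index_mem.
pose s := mkseq (fun a => p - 1 - l a - (2 * m * a)%N%:Z) k.+1.
have size_s : size s = k.+1 by rewrite size_mkseq.
have partE a : (a < k.+1)%N -> part s a = l a.
  by move=> lt_ak; rewrite /part nth_mkseq //; lia.
have part_seq d : mkseq (fun a => part s a + d a) k.+1 =
    mkseq (fun a => l a + d a) k.+1.
  by apply/eq_in_map => a; rewrite mem_iota => /andP[_ ?]; rewrite partE.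
have part_seq0 : mkseq (part s) k.+1 = r.
  by rewrite rE; apply/eq_in_map => a; rewrite mem_iota => /andP[_ ?]; rewrite partE.
have := word_raising s; rewrite size_s part_seq0 (creation_word_perm _ r_mu) => near_word.
rewrite -[creation_word _ _](subrK (word s)) -opprB; apply: spanD; last first.
  apply: span_mem; exists s; split => //.
    rewrite admissibleE; apply/andP; split.
      by rewrite nth_mkseq //; have := l_ge0 0%N isT; lia.
    apply/(sortedP 0) => a; rewrite size_s => lt_ak.
    rewrite !nth_mkseq ?(ltnW lt_ak) //.
    have := l_mono a a.+1 (leqnSn a) lt_ak; lia.
  by rewrite -nth_last size_s nth_mkseq //=; lia.
rewrite -scaleN1r; apply: spanZ; apply: span_sub near_word => _ [d rd ->].
rewrite part_seq; have [neg|nneg] := boolP (has (< 0) (mkseq (fun a => l a + d a) k.+1)).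
  by rewrite creation_word_lt0 //; apply: span0.
apply: IHN; first 1 last.
- by rewrite size_mkseq.
- by apply: contraNT nneg; rewrite -has_predC; apply: sub_has => x /=; rewrite -ltNge.
- apply/hasP; exists (l k + d k); last by rewrite ler_wpDr // (raising_last rd).
  by apply/mapP; exists k => //; rewrite mem_iota /=.
rewrite !big_mkseq (raising_sum l rd).
have := raising_norm rd l_mono.
have sum_mu (f : int -> int) : \sum_(x <- mu) f x = \sum_(0 <= a < k.+1) f (l a).
  by rewrite -(perm_big _ r_mu) rE big_mkseq.
have arith (a c c' : int) : a - c < N.+1%:Z -> c < c' -> a - c' < N%:Z by lia.
by rewrite !sum_mu in lt_mu; apply: arith lt_mu.
Qed.

(** The first entry of each product in the expansion of the word is at least
p - 1 - i - 2m (size s), which creation_word_span turns into a bound on the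
last index. *)
Lemma word_span i s :
  lin_span (admissible_word (size s) i) (word (i :: s)).
Proof.
set k := size s; pose K := p - 1 - i - (2 * m * k)%N%:Z.
have in_span (mu : seq int) : size mu = k.+1 -> K <= nth 0 mu 0 ->
    lin_span (admissible_word k i) (creation_word (charge k.+1) mu).
  move=> size_mu le_K; have [neg|nneg] := boolP (has (< 0) mu).
    by rewrite creation_word_lt0 //; apply: span0.
  have -> : i = p - 1 - K - (2 * m * k)%N%:Z by rewrite /K; lia.
  apply: creation_word_span => //.
    by apply: contraNT nneg; rewrite -has_predC; apply: sub_has => x /=; rewrite -ltNge.
  by apply/hasP; exists (nth 0 mu 0) => //; rewrite mem_nth ?size_mu.
have := word_raising (i :: s); rewrite -[size (i :: s)]/k.+1 => near.
rewrite -[word _](subrK (creation_word (charge k.+1) (mkseq (part (i :: s)) k.+1))).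
apply: spanD; last first.
  by apply: in_span; rewrite ?size_mkseq // /K /part /=; lia.
apply: span_sub near => _ [d [_ _ d0] ->]; apply: in_span; rewrite ?size_mkseq //.
by move: d0; rewrite /K /part /=; lia.
Qed.

(** * Independence and bases *)

Hypothesis m_gt0 : (0 < m)%N.
Hypothesis creation_word_dual : forall q (mu : seq int), all (>= 0) mu ->
  exists f : V -> F^o, [/\ linear f, f (creation_word q mu) = 1 &
    forall q' (nu : seq int), f (creation_word q' nu) != 0 ->
      q' = q /\ (size nu = size mu -> perm_eq nu mu)].

Section Admissible.
Variable s : seq int.
Hypothesis adm_s : admissible m p s.

Lemma part_mono a a' : (a <= a')%N -> (a' < size s)%N -> part s a <= part s a'.
Proof.
have [_ /(sortedP 0) adm] := andP adm_s.
elim: a' => [|a' IHa']; first by rewrite leqn0 => /eqP ->.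
rewrite leq_eqVlt => /predU1P[-> //|le_aa'] lt_a's.
apply: le_trans (IHa' le_aa' (ltnW lt_a's)) _.
by have := adm a' lt_a's; rewrite /part; lia.
Qed.

Lemma part_ge0 a : (a < size s)%N -> 0 <= part s a.
Proof.
move=> lt_as; apply: le_trans (part_mono (leq0n a) lt_as).
have [_ _] := andP adm_s; move: adm_s lt_as; case: (s) => // i t.
by case/andP=> + _ _; rewrite /part /=; lia.
Qed.

Lemma admissible_le i : i \in s -> i <= p - 1.
Proof.
move=> is_; have lt_is : (index i s < size s)%N by rewrite index_mem.
by have := part_ge0 lt_is; rewrite /part nth_index //; lia.
Qed.

Lemma all_part_ge0 : all (>= 0) (mkseq (part s) (size s)).
Proof.
by apply/allP => _ /mapP[a + ->]; rewrite mem_iota => /andP[_]; apply: part_ge0.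
Qed.

Lemma sorted_part : sorted <=%R (mkseq (part s) (size s)).
Proof.
apply/(sortedP 0) => a; rewrite size_mkseq => lt_as.
by rewrite !nth_mkseq ?(ltnW lt_as) // part_mono.
Qed.

End Admissible.

Lemma part_inj s t : size s = size t ->
  mkseq (part s) (size s) = mkseq (part t) (size t) -> s = t.
Proof.
move=> st; rewrite -st => eq_part; apply: (eq_from_nth (x0 := 0)) => // a lt_as.
have := congr1 (nth 0 ^~ a) eq_part; rewrite !nth_mkseq // /part; lia.
Qed.

Lemma charge_inj : injective charge.
Proof.
move=> k l; rewrite /charge => /addIr[] /eqP.
by rewrite eqn_pmul2l ?muln_gt0 ?m_gt0 // => /eqP.
Qed.

Definition part_norm s : int := \sum_(0 <= a < size s) part s a ^+ 2.

(** Suppose that the coefficients of all words with smaller part_norm vanish.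
A functional dual to the leading product of s0 kills every other word with
nonzero coefficient: the leading products differ, and the other products in
the expansion have sums of squares larger than that of s0. *)
Lemma word_free (S : seq (seq int)) (c : seq int -> F) : uniq S ->
  (forall s, s \in S -> admissible m p s) ->
  \sum_(s <- S) c s *: word s = 0 -> forall s, s \in S -> c s = 0.
Proof.
move=> uniq_S adm_S sum0 s.
have [N] := ubnP (absz (part_norm s)); elim: N s => // N IHN s0 le_s0N s0S.
have small s : s \in S -> part_norm s < part_norm s0 -> c s = 0.
  move=> sS lt_ss0; apply: IHN => //.
  have s_ge0 : 0 <= part_norm s by apply: sumr_ge0 => a _; apply: sqr_ge0.
  by lia.
have [f [f_lin f1 f0]] :=
  creation_word_dual (charge (size s0)) (all_part_ge0 (adm_S _ s0S)).
have f_span T x : (forall y, T y -> f y = 0) -> lin_span T x -> f x = 0.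
  move=> fT; elim/span_ind: x / => [|a x y Tx fy]; first exact: lin0.
  by rewrite f_lin fy fT // scaler0 addr0.
(* When c s <> 0, the functional f sees only the leading product of word s. *)
have f_rest s : s \in S -> c s != 0 ->
    f (word s) = f (creation_word (charge (size s)) (mkseq (part s) (size s))).
  move=> sS cs; apply/eqP; rewrite -subr_eq0 -(linB f_lin); apply/eqP.
  apply: f_span (word_raising s) => _ [d rd ->]; apply: contra_neq_eq cs => fd.
  have [/charge_inj ss0 perm_d] := f0 _ _ fd; apply: small => //.
  have <- : \sum_(0 <= a < size s) (part s a + d a) ^+ 2 = part_norm s0.
    rewrite -(big_mkseq (fun a => part s a + d a) (fun x => x ^+ 2)).
    by rewrite (perm_big _ (perm_d _)) ?size_mkseq // big_mkseq.
  exact: raising_norm rd (part_mono (adm_S _ sS)).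
have := congr1 f sum0; rewrite (lin0 f_lin) (lin_sum f_lin) (bigD1_seq s0) //=.
rewrite big_seq_cond big1 ?addr0; last first.
  move=> s /andP[sS ss0]; rewrite (linZ f_lin); have [->|cs] := eqVneq (c s) 0.
    by rewrite scale0r.
  rewrite f_rest //; apply/eqP/negPn; apply: contra ss0 => fs.
  have /f0[/charge_inj ss0 perm_ss0] :
      f (creation_word (charge (size s)) (mkseq (part s) (size s))) != 0.
    by apply: contraNneq fs => ->; rewrite scaler0.
  apply/eqP/part_inj => //; apply: (sorted_eq le_trans le_anti).
  - exact/sorted_part/adm_S.
  - exact/sorted_part/adm_S.
  - by apply: perm_ss0; rewrite !size_mkseq.
rewrite (linZ f_lin); have [-> //|cs] := eqVneq (c s0) 0.
by rewrite f_rest // f1 [_ *: _]mulr1.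
Qed.

Definition word_space : V -> Prop :=
  lin_span (fun x => exists s : seq int,
    (forall i, i \in s -> i <= p - 1) /\ x = word s).

Lemma word_admissible_span s :
  lin_span (fun y => exists2 t, admissible m p t & y = word t) (word s).
Proof.
case: s => [|i s]; first by apply: span_mem; exists [::].
by apply: span_sub (word_span i s) => _ [t [? _ _ ->]]; apply: span_mem; exists t.
Qed.

Lemma admissible_word_space s : admissible m p s -> word_space (word s).
Proof.
by move=> adm_s; apply: span_mem; exists s; split=> // i; apply: admissible_le.
Qed.

Lemma words_basis : subspace_basis (fun s => admissible m p s) word word_space.
Proof.
split=> [_ ->|||x Ux].
- exact: span0.
- exact: admissible_word_space.
- exact: word_free.
have /span_family[s [c [_ adm_s ->]]] :
    lin_span (fun y => exists2 t, admissible m p t & y = word t) x.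
  by apply: span_sub Ux => _ [s [_ ->]]; apply: word_admissible_span.
by exists s, c; rewrite subrr.
Qed.

Definition low_space (N : int) : V -> Prop :=
  lin_span (fun x => exists (i : int) (v : V),
    [/\ i <= N, word_space v & x = mode i v]).

Lemma low_space_sub N x : low_space N x ->
  lin_span (fun y => exists2 s, admissible m p s && ~~ last_above N s
                              & y = word s) x.
Proof.
apply: span_sub => _ [i [v [le_iN Uv ->]]].
apply: (span_map (mode_lin i) _ Uv) => _ [s [_ ->]].
apply: span_sub (word_span i s) => _ [[|j t] [adm_t // _ le_ti ->]].
apply: span_mem; exists (j :: t) => //.
by rewrite adm_t /= -leNgt (le_trans le_ti).
Qed.

(** The modes commute, so the last one can be moved to the front. *)
Lemma low_space_word N s : admissible m p s -> ~~ last_above N s ->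
  low_space N (word s).
Proof.
case: s => // j s adm_s; rewrite -[last_above _ _]/(N < last j s) -leNgt => le_sN.
have perm_s : perm_eq (j :: s) (last j s :: belast j s).
  by rewrite lastI perm_rcons.
rewrite (word_perm perm_s); apply: span_mem; exists (last j s), (word (belast j s)).
split=> //; apply: span_mem; exists (belast j s); split=> // i is_.
by apply: (admissible_le adm_s); rewrite (perm_mem perm_s) inE is_ orbT.
Qed.

(** By low_space_sub and low_space_word, low_space N has for basis the admissible
words whose last index is at most N; these complete the words of the statement
to a basis of word_space. *)
Lemma quotient_words_basis N :
  quotient_basis (fun s => admissible m p s && last_above N s) word
    word_space (low_space N).
Proof.
split=> [x /low_space_sub|s /andP[adm_s _]|S c uniq_S adm_S|x Ux].
- by apply: span_sub => _ [s /andP[adm_s _] ->]; apply: admissible_word_space.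
- exact: admissible_word_space.
- case/low_space_sub/span_family=> S' [c' [uniq_S' adm_S' eq_SS']] s sS.
  (* The relation modulo low_space N, as one relation between admissible words *)
  pose c'' t := if last_above N t then c t else - c' t.
  have := @word_free (S ++ S') c''; rewrite /c'' => free.
  have := free _ _ _ s; have [_ ->] := andP (adm_S _ sS); apply.
  + rewrite cat_uniq uniq_S uniq_S' andbT /=; apply/hasPn => t /adm_S'/andP[_].
    by apply: contraNN => /adm_S/andP[].
  + by move=> t; rewrite mem_cat => /orP[/adm_S/andP[]|/adm_S'/andP[]].
  + rewrite big_cat /= [X in X + _]big_seq [X in _ + X]big_seq.
    under eq_bigr => t /adm_S/andP[_ ->] do [].
    under [X in _ + X]eq_bigr => t /adm_S'/andP[_ /negPf ->] do rewrite scaleNr.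
    by rewrite -!big_seq sumrN eq_SS' subrr.
  + by rewrite mem_cat sS.
have [_ _ _ /(_ x Ux)[S [c [adm_S /eqP]]]] := words_basis.
rewrite subr_eq0 => /eqP ->.
exists [seq s <- S | last_above N s], c; split=> [s|].
  by rewrite mem_filter => /andP[-> /adm_S ->].
rewrite big_filter [X in X - _](bigID (last_above N)) /= addrAC subrr add0r.
rewrite big_seq_cond; apply: span_sum => s /andP[/adm_S adm_s low_s].
exact/spanZ/low_space_word.
Qed.

End Words.

(** * Independence of the products of creation coefficients *)

Lemma course_of_values (T : Type) (x0 : T) (next : nat -> (nat -> T) -> T) :
  (forall n f g, (forall k, (k < n)%N -> f k = g k) -> next n f = next n g) ->
  exists f, forall n, f n = next n f.
Proof.
move=> next_ext.
pose step N := iter N (fun f k => next k f) (fun=> x0).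
have stepE N M k : (k < N)%N -> (k < M)%N -> step N k = step M k.
  elim: N M k => // N IHN [|M] // k lt_kN lt_kM; apply: next_ext => l lt_lk.
  by apply: IHN; apply: leq_trans lt_lk _.
exists (fun n => step n.+1 n) => n; apply: next_ext => k lt_kn.
exact: stepE.
Qed.

Lemma malgUM (R : nzRingType) (mu nu : {cmonom nat}) :
  << mu >> * << nu >> = << mulcm mu nu >> :> {malg R[{cmonom nat}]}.
Proof. by rewrite malgM_def fgmulUU mulr1. Qed.

Section PolynomialModel.
Variables (F : numFieldType) (V : lmodType F) (alpha : F) (h : int -> V -> V).
Hypothesis alpha_neq0 : alpha != 0.
Hypothesis heis_lin : forall i, linear (h i).
Hypothesis heis_comm : forall i j x,
  h i (h j x) - h j (h i x) = (i *+ (i + j == 0))%:~R *: x.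
Variable basis : int -> {cmonom nat} -> V.
Hypothesis heis_basis : forall j q mu,
  h (- j.+1%:Z) (basis q mu) = basis q (mulcm mu (ucm j)).
Hypothesis basis_ext : forall (W : lmodType F) (f g : V -> W),
  linear f -> linear g -> (forall q mu, f (basis q mu) = g (basis q mu)) ->
  forall x, f x = g x.
Hypothesis basis_lift : forall (W : lmodType F) (c : int -> {cmonom nat} -> W),
  exists2 f : V -> W, linear f & forall q mu, f (basis q mu) = c q mu.
Notation E := (creation alpha h).
Notation vac q := (basis q (onecm nat)).

Section Algebra.
Variables (P : comAlgType F) (gen : nat -> P).
Hypothesis gen0 : gen 0%N = 1.

(** Newton's identities: they determine the images of the h_(-n) when those of
the E_n are prescribed. *)
Lemma newton : exists H : nat -> P, forall n : nat,
  n%:R *: gen n = alpha *: \sum_(1 <= k < n.+1) H k * gen (n - k).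
Proof.
(* The n-th identity solved for H n: the term k = n is H n * gen 0 = H n. *)
pose next n (H : nat -> P) : P := alpha^-1 *: (n%:R *: gen n) -
  \sum_(1 <= k < n) H k * gen (n - k).
have [n f g fg|H HE] := course_of_values 0 (next := next).
  by congr (_ - _); apply: eq_big_nat => k /andP[_ lt_kn]; rewrite fg.
exists H => -[|n]; first by rewrite big_nil scale0r scaler0.
rewrite big_nat_recr //= subnn gen0 mulr1 [H n.+1]HE addrC subrK.
by rewrite scalerA mulfV // scale1r.
Qed.

(** The h_(-n) act freely on the vacuum of charge q, so they can be sent to the
elements H n of newton; then each E_n is sent to gen n, as both sides satisfy
the same recurrence.  Hence the E_n with n > 0 are as independent as any
prescribed sequence gen.  Vectors of other charges are sent to 0. *)
Lemma polynomial_model q :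
  exists2 f : V -> P, linear f & forall q' (nu : seq int),
    f (creation_word (fun q => vac q) E q' nu) =
    if (q' == q) && all (>= 0) nu then \prod_(j <- nu) gen (absz j) else 0.
Proof.
have [H HE] := newton.
pose hmon (nu : {cmonom nat}) : P := \prod_(j <- finsupp nu) H j.+1 ^+ nu j.
have hmon1 : hmon (onecm nat) = 1 by rewrite /hmon mdom1 big_seq_fset0.
have hmonM nu j : hmon (mulcm nu (ucm j)) = H j.+1 * hmon nu.
  have hmonE (d : {fset nat}) (rho : {cmonom nat}) :
      (finsupp rho `<=` d)%fset -> hmon rho = \prod_(i <- d) H i.+1 ^+ rho i.
    move=> le_d; rewrite /hmon (big_fset_incl _ le_d) // => i _.
    by rewrite memNfinsupp => /eqP ->; rewrite expr0.
  pose d := (finsupp (mulcm nu (ucm j)) `|` (finsupp nu `|` [fset j]))%fset.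
  rewrite (hmonE d) ?fsubsetUl // (hmonE d nu); last first.
    by rewrite fsubsetU // fsubsetUl orbT.
  have jd : j \in d by rewrite !inE eqxx !orbT.
  rewrite (bigD1_seq j) ?fset_uniq //= [in RHS](bigD1_seq j) ?fset_uniq //=.
  rewrite mulcmE ucmE eqxx addn1 exprS -!mulrA; congr (_ * (_ * _)).
  apply: eq_bigr => i /negPf ij; rewrite mulcmE ucmE eq_sym.
  by rewrite ij addn0.
have [f f_lin fE] := basis_lift (fun q' nu => if q' == q then hmon nu else 0).
exists f => //.
have f_heis j x : (0 < j)%N -> f (h (- j%:Z) x) = H j * f x.
  case: j => // j _; move: x.
  apply: (basis_ext (f := fun x => f (h (- j.+1%:Z) x)) (g := fun x => H j.+1 * f x)).
  - by move=> c x y; rewrite heis_lin f_lin.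
  - by move=> c x y; rewrite f_lin mulrDr scalerAr.
  by move=> q' mu; rewrite heis_basis !fE hmonM; case: ifP; rewrite ?mulr0.
have f_E (j : nat) x : f (E j x) = gen j * f x.
  elim/ltn_ind: j => j IHj; have [->|j_gt0] := posnP j.
    by rewrite creation0 gen0 mul1r.
  have j_neq0 : j%:R != 0 :> F by rewrite pnatr_eq0 -lt0n.
  apply: (scalerI j_neq0); rewrite -(linZ f_lin) creation_rec // (linZ f_lin).
  rewrite scalerAl HE -scalerAl (lin_sum f_lin) mulr_suml; congr (_ *: _).
  apply: eq_big_nat => k /andP[k_gt0 le_kj].
  by rewrite f_heis // IHj ?mulrA //; lia.
move=> q' nu; elim: nu => [|[j|j] nu IHnu] /=.
- by rewrite fE andbT big_nil; case: ifP.
- by rewrite f_E IHnu big_cons; case: ifP; rewrite ?mulr0.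
- by rewrite andbF (lin0 f_lin).
Qed.

End Algebra.

Notation P := {malg F[{cmonom nat}]}.

(** The image of E_j in the polynomial ring whose variables are the images of
E_1, E_2, ...; E_0 is the identity. *)
Definition gen (j : nat) : P := if j is j'.+1 then << ucm j' >> else 1.

Lemma prod_gen (nu : seq int) : all (>= 0) nu -> exists2 mu : {cmonom nat},
  \prod_(j <- nu) gen (absz j) = << mu >> & forall i, mu i = count_mem i.+1%:Z nu.
Proof.
elim: nu => [_|[j|j] nu IHnu] //=.
  by exists (onecm nat); [rewrite big_nil | move=> i; rewrite onecmE].
case/IHnu => mu nuE muE; case: j => [|j].
  by exists mu; [rewrite big_cons mul1r | move=> i; rewrite muE].
exists (mulcm (ucm j) mu); last by move=> i; rewrite mulcmE ucmE muE.
by rewrite big_cons nuE; apply: malgUM.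
Qed.

(** Factors E_0 are invisible in a product, but their number is determined by
the length. *)
Lemma count_perm (mu nu : seq int) : all (>= 0) mu -> all (>= 0) nu ->
  size nu = size mu ->
  (forall i : nat, count_mem i.+1%:Z nu = count_mem i.+1%:Z mu) -> perm_eq nu mu.
Proof.
move=> mu_ge0 nu_ge0 size_nu count_nu; pose nz : pred int := predC1 0.
have count_nz x : 0 < x -> count_mem x nu = count_mem x mu.
  by case: x => [[|i]|i] // _; apply: count_nu.
have mem_ge0 x : x \in nu ++ mu -> 0 <= x.
  by rewrite mem_cat => /orP[/(allP nu_ge0)|/(allP mu_ge0)].
have perm_nz : perm_eq (filter nz nu) (filter nz mu).
  apply/allP => x; rewrite -filter_cat mem_filter => /andP[x_neq0 /mem_ge0 x_ge0].
  rewrite /= !count_filter; apply/eqP.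
  have x_gt0 : 0 < x by rewrite lt_def x_ge0 andbT.
  have eqx (t : seq int) : count (predI (pred1 x) nz) t = count_mem x t.
    by apply: eq_count => y /=; case: eqVneq => // ->; rewrite x_neq0.
  by rewrite !eqx count_nz.
apply/allP => x /mem_ge0; rewrite le_eqVlt => /predU1P[<-|/count_nz eq_x]; last exact/eqP.
apply/eqP.
have := perm_size perm_nz; rewrite !size_filter => eq_nz.
have := count_predC (pred1 (0 : int)) nu; rewrite size_nu.
rewrite -(count_predC (pred1 (0 : int)) mu) -/nz eq_nz => /addIn.
exact.
Qed.

(** The coefficient of a monomial in polynomial_model. *)
Lemma creation_word_dual q (mu : seq int) : all (>= 0) mu ->
  exists f : V -> F^o, [/\ linear f, f (creation_word (fun q => vac q) E q mu) = 1 &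
    forall q' (nu : seq int), f (creation_word (fun q => vac q) E q' nu) != 0 ->
      q' = q /\ (size nu = size mu -> perm_eq nu mu)].
Proof.
move=> mu_ge0; have [f f_lin fE] := @polynomial_model _ gen (erefl _) q.
have [mon monE count_mon] := prod_gen mu_ge0.
exists (fun x => (f x)@_mon); split.
- by move=> c x y; rewrite f_lin mcoeffD mcoeffZ.
- by rewrite fE eqxx mu_ge0 monE mcoeffUU.
move=> q' nu; rewrite fE; case: andP => [[/eqP -> nu_ge0]|_]; last first.
  by rewrite mcoeff0 eqxx.
have [mon' -> count_mon'] := prod_gen nu_ge0.
rewrite mcoeffU; case: (eqVneq mon' mon) => [mon_eq _|_]; last first.
  by rewrite eqxx.
by split=> // size_nu; apply: count_perm => // i; rewrite -count_mon -count_mon' mon_eq.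
Qed.

End PolynomialModel.

(** * The Fock space *)

Lemma malg_lift (R : fieldType) (K : choiceType) (W : lmodType R) (c : K -> W) :
  exists2 f : {malg R[K]} -> W, linear f & forall k, f << k >> = c k.
Proof.
pose f (x : {malg R[K]}) := \sum_(k <- msupp x) x@_k *: c k; exists f; last first.
  by move=> k; rewrite /f msuppU oner_eq0 big_seq_fset1 mcoeffUU scale1r.
have fE (d : {fset K}) x : (msupp x `<=` d)%fset -> f x = \sum_(k <- d) x@_k *: c k.
  move=> le_d; rewrite /f (big_fset_incl _ le_d) // => k _.
  by rewrite -mcoeff_eq0 => /eqP ->; rewrite scale0r.
move=> a x y; pose d := (msupp (a *: x + y) `|` (msupp x `|` msupp y))%fset.
rewrite !(fE d) ?fsubsetUl //; first last.
- by rewrite fsubsetU // fsubsetUl orbT.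
- by rewrite fsubsetU // fsubsetUr orbT.
rewrite scaler_sumr -big_split /=; apply: eq_bigr => k _.
by rewrite mcoeffD mcoeffZ scalerDl scalerA.
Qed.

Lemma lin_comp (F : fieldType) (U V W : lmodType F) (f : V -> W) (g : U -> V) :
  linear f -> linear g -> linear (fun x => f (g x)).
Proof. by move=> f_lin g_lin c x y; rewrite g_lin f_lin. Qed.

Lemma lin_subZ (F : fieldType) (U V : lmodType F) (f g : U -> V) (a : F) :
  linear f -> linear g -> linear (fun x => f x - a *: g x).
Proof.
move=> f_lin g_lin c x y; rewrite f_lin g_lin scalerDr opprD addrACA scalerBr.
by rewrite !scalerA [a * c]mulrC.
Qed.

Lemma malgUZ (R : nzRingType) (K : choiceType) (c : R) (k : K) :
  << c *g k >> = c *: (<< k >> : {malg R[K]}).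
Proof. by apply/malgP => k'; rewrite mcoeffZ !mcoeffU mulrnAr mulr1. Qed.

Lemma cmonom_ind (P : {cmonom nat} -> Prop) :
  P (onecm nat) -> (forall j mu, P mu -> P (mulcm mu (ucm j))) -> forall mu, P mu.
Proof.
move=> P1 PM mu; have [d] := ubnP (mdeg mu); elim: d mu => // d IHd mu lt_mud.
have [supp0|[j jmu]] := fset_0Vmem (finsupp mu).
  suff -> : mu = onecm nat by [].
  by apply: mdeg_eq0I; rewrite mdegE supp0 big_seq_fset0.
have mu_j : (0 < mu j)%N by rewrite lt0n cmE_neq0.
have muE : mu = mulcm (divcm mu (ucm j)) (ucm j).
  apply/eqP/cmP => i; rewrite mulcmE divcmE ucmE.
  by case: eqVneq => [<-|_]; rewrite ?subnK // subn0 addn0.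
rewrite muE; apply/PM/IHd; move: lt_mud; rewrite {1}muE.
by rewrite (mdegM (divcm mu (ucm j)) (ucm j)) mdegU addn1.
Qed.

Section FockSpace.
Variables (C : numClosedFieldType) (m : nat).
Hypothesis m_gt0 : (0 < m)%N.

(* The scalars form a numFieldType, as in the preceding sections. *)
Let F : numFieldType := C.
Let fock : lmodType F := Defs.fock C.
Let alpha : F := Defs.alpha C m.
Let h : int -> fock -> fock := @heis C m.
Let mode : int -> fock -> fock := @Defs.mode C m.
Let vac : int -> fock := Defs.vac C.
Notation E := (creation alpha h).
Notation G := (annihilation alpha h).

Lemma alpha_sqr : alpha * alpha = (2 * m)%:R.
Proof. by rewrite -expr2 sqrtCK. Qed.

Lemma alpha_neq0 : alpha != 0.
Proof. by rewrite sqrtC_eq0 pnatr_eq0 muln_eq0 /= -lt0n. Qed.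

Lemma heis_lin i : linear (h i). Proof. exact: linearP. Qed.

Lemma mode_lin n : linear (mode n). Proof. exact: linearP. Qed.

(** As a vector of the Fock space, rather than of the bare monoid algebra. *)
Definition basis (k : fock_index) : fock := << k >>.

Lemma fock_basis_ind (P : fock -> Prop) :
  (forall c x y, P x -> P y -> P (c *: x + y)) -> (forall k, P (basis k)) ->
  forall x, P x.
Proof.
move=> P_lin P_basis x; have P0 : P 0.
  have := P_lin (-1) _ _ (P_basis (0, onecm nat)) (P_basis (0, onecm nat)).
  by rewrite scaleN1r addNr.
rewrite [x]monalgE; elim/big_rec: _ => // k y _ Py.
rewrite malgUZ; exact: P_lin (P_basis k) Py.
Qed.

Lemma fock_lin_eq (W : lmodType F) (f g : fock -> W) : linear f -> linear g ->
  (forall k, f (basis k) = g (basis k)) -> forall x, f x = g x.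
Proof.
move=> f_lin g_lin fg; elim/fock_basis_ind => // c x y fgx fgy.
by rewrite f_lin g_lin fgx fgy.
Qed.

Lemma heis_opp j k : (0 < j)%N ->
  h (- j%:Z) (basis k) = basis (k.1, mulcm k.2 (ucm j.-1)).
Proof. by case: j => // j _; rewrite -NegzE; apply: heisU. Qed.

Lemma vac_generates (P : fock -> Prop) :
  (forall c x y, P x -> P y -> P (c *: x + y)) -> (forall q, P (vac q)) ->
  (forall j x, (0 < j)%N -> P x -> P (h (- j%:Z) x)) -> forall x, P x.
Proof.
move=> P_lin P_vac P_heis; elim/fock_basis_ind => // -[q mu].
elim/cmonom_ind: mu => [|j mu IHmu]; first exact: P_vac.
by have := P_heis j.+1 _ isT IHmu; rewrite heis_opp.
Qed.

(** The defining sum may be extended, because annihilation lowers the weight.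
A common bound for several vectors makes their expansions comparable. *)
Lemma modeU n (k : fock_index) b : (weight k.2 < b)%N ->
  mode n (basis k) = \sum_(0 <= l < b)
    E (l%:Z - k.1 - n - 1) (G l (basis (k.1 + (2 * m)%:Z, k.2))).
Proof.
move=> lt_kb; rewrite [LHS]lin_extU [RHS](big_cat_nat (n := (weight k.2).+1)) //=.
rewrite [X in _ = _ + X]big_nat [X in _ = _ + X]big1 ?addr0.
  rewrite big_mkord; apply: eq_bigr => l _; rewrite shiftU.
  by case: (_ - 1).
move=> l /andP[lt_kl _].
have -> : G l (basis (k.1 + (2 * m)%:Z, k.2)) = 0.
  exact: annihilation_coef_eq0.
by apply: lin0; apply: creation_lin; apply: heis_lin.
Qed.

Lemma mode_vac n q :
  mode n (vac q) = E (- q - n - 1) (vac (q + (2 * m)%:Z)).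
Proof.
rewrite (@modeU _ _ 1) /=; last by rewrite /weight mdom1 big_seq_fset0.
by rewrite big_nat1 annihilation0 sub0r.
Qed.

Lemma mode_heis n j x : (0 < j)%N ->
  mode n (h (- j%:Z) x) = h (- j%:Z) (mode n x) - alpha *: mode (n - j%:Z) x.
Proof.
move=> j_gt0; move: x; apply: (fock_lin_eq (f := fun x => mode n (h (- j%:Z) x))
  (g := fun x => h (- j%:Z) (mode n x) - alpha *: mode (n - j%:Z) x)).
- exact: lin_comp (mode_lin n) (heis_lin _).
- by apply: lin_subZ (mode_lin _); apply: lin_comp (heis_lin _) (mode_lin n).
case=> q mu; cbv beta; set x := basis (q + (2 * m)%:Z, mu).
pose b := (weight mu).+1; rewrite heis_opp; last exact: j_gt0.
rewrite [LHS](@modeU _ _ (b + j)%N); last by rewrite weightM weightU prednK.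
rewrite [X in h _ X](@modeU n _ (b + j)%N); last by rewrite leq_addr.
rewrite [X in _ *: X](@modeU (n - j%:Z) _ b); last exact: leqnn.
have -> : basis ((q, mulcm mu (ucm j.-1)).1 + (2 * m)%:Z,
    (q, mulcm mu (ucm j.-1)).2) = h (- j%:Z) x.
  by rewrite heis_opp.
have cE l k : l%:Z - q - k - 1 = l%:Z + (- q - k - 1) by lia.
have key :=
  vertex_sum_heis alpha heis_lin (@heis_comm C m) (- q - n - 1) b x j_gt0.
apply: etrans (etrans key _); first by apply: eq_bigr => l _; rewrite /= cE.
have eq_terms c k a : - q - k - 1 = c ->
    \sum_(0 <= l < a) E (l%:Z + c) (G l x) =
    \sum_(0 <= l < a) E (l%:Z - (q, mu).1 - k - 1)
      (G l (basis ((q, mu).1 + (2 * m)%:Z, (q, mu).2))).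
  by move=> <-; apply: eq_bigr => l _; rewrite -cE.
have R1 := eq_terms (- q - n - 1) n (b + j)%N (erefl _).
have R2 : - q - (n - j%:Z) - 1 = - q - n - 1 + j%:Z by lia.
have R3 := eq_terms _ _ b R2.
rewrite R1 R3; reflexivity.
Qed.

Lemma heis_basis j q mu :
  h (- j.+1%:Z) (basis (q, mu)) = basis (q, mulcm mu (ucm j)).
Proof. exact: heis_opp. Qed.

Lemma basis_lift (W : lmodType F) (c : int -> {cmonom nat} -> W) :
  exists2 f : fock -> W, linear f & forall q mu, f (basis (q, mu)) = c q mu.
Proof.
have [f f_lin fE] := malg_lift (fun k : fock_index => c k.1 k.2).
by exists f => // q mu; apply: fE.
Qed.

Lemma basis_ext (W : lmodType F) (f g : fock -> W) : linear f -> linear g ->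
  (forall q mu, f (basis (q, mu)) = g (basis (q, mu))) -> forall x, f x = g x.
Proof. by move=> f_lin g_lin fg; apply: fock_lin_eq => // -[]. Qed.

Lemma fock_word_dual q (mu : seq int) : all (>= 0) mu ->
  exists f : fock -> F^o, [/\ linear f, f (creation_word vac E q mu) = 1 &
    forall q' (nu : seq int), f (creation_word vac E q' nu) != 0 ->
      q' = q /\ (size nu = size mu -> perm_eq nu mu)].
Proof.
exact: (creation_word_dual alpha_neq0 heis_lin (@heis_comm C m) heis_basis basis_ext
  basis_lift).
Qed.

Let creation_lin := creation_lin alpha heis_lin.
Let creation_comm := creation_comm alpha heis_lin (@heis_comm C m).
Let fock_mode_comm := mode_comm heis_lin (@heis_comm C m) alpha_sqr mode_lin
  mode_heis mode_vac vac_generates.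
Let fock_mode_creation :=
  mode_creation heis_lin (@heis_comm C m) alpha_sqr mode_lin mode_heis.

Lemma admissible_bases (p : int) :
  subspace_basis (fun s => admissible m p s) (@mode_word C m p) (@principal C m p)
  /\ forall N : int,
    quotient_basis (fun s => admissible m p s && last_above N s)
      (@mode_word C m p) (@principal C m p) (@mode_image C m p N).
Proof.
split=> [|N].
  exact: (words_basis creation_lin creation_comm
    (@creation_lt0 _ _ alpha h) mode_lin mode_vac fock_mode_creation p m_gt0
    fock_word_dual).
exact: (quotient_words_basis creation_lin creation_comm
  (@creation_lt0 _ _ alpha h) mode_lin fock_mode_comm mode_vac
   fock_mode_creation p m_gt0 fock_word_dual N).
Qed.

End FockSpace.

Theorem mainTheorem1 (R : realType) (m : nat) (hm : (1 <= m)%N) (p : int) :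
  subspace_basis (fun s => admissible m p s) (@mode_word R[i] m p)
    (@principal R[i] m p)
  /\
  forall N : int,
    quotient_basis (fun s => admissible m p s && last_above N s)
      (@mode_word R[i] m p) (@principal R[i] m p) (@mode_image R[i] m p N).
Proof. exact: admissible_bases. Qed.
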